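(* Let $X\in\mathbb{R}^{n\times d}$ be fixed with rows $x_1,\dots,x_n$ and columns $X_1,\dots,X_d$ satisfying $\|X_j\|_2\le\sqrt n$ for each $j$. Let $Y_1,\dots,Y_n$ be independent with $Y_i\sim P_i$, $\mu_i=\mathbb{E}[Y_i]$, $\mu=(\mu_1,\dots,\mu_n)$. Let $f(\theta)=\frac1n\big(-Y^\top X\theta+\sum_{i=1}^nA(x_i^\top\theta)\big)$, and consider the following cases: Case 1, Gaussian (linear regression): $P_i=\mathcal{N}(\mu_i,\sigma_i^2)$, $A(u)=u^2/2$, and $\sigma=\max_{i}\sigma_i$. Case 2, Bernoulli (logistic regression): $P_i=\mathrm{Bern}(\mu_i)$, $A(u)=\log(1+e^u)$, and $\sigma=\frac12$. Case 3, Poisson (Poisson regression): $P_i=\mathrm{Pois}(\mu_i)$, $A(u)=e^u$, and $\sigma=(6\|\mu\|_\infty+2)\log n+3\sqrt{\|\mu\|_\infty}$. These losses are $L$-smooth on $\Delta_d$ with respect to $\|\cdot\|_1$, where $L=\frac1n\sum_{i=1}^n\|x_i\|_\infty^2$ in case 1, $L=\frac1{4n}\sum_{i=1}^n\|x_i\|_\infty^2$ in case 2, and $L=\frac1n\sum_{i=1}^ne^{\|x_i\|_\infty}\|x_i\|_\infty^2$ in case 3. Consider exponentiated gradient descent $\tilde\theta_{t+1}=\theta_t\odot\exp(-\eta\nabla f(\theta_t))$, $\theta_{t+1}=\tilde\theta_{t+1}/\|\tilde\theta_{t+1}\|_1$, $t=0,1,2,\dots$, with constant step size $\eta\in(0,1/L]$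 and $\theta_0=u\in\Delta_d$. Fixing any $\delta>0$ and $b>0$, let $$\lambda_T^*=\sigma\sqrt{\frac{\log(2d)+\delta}{bn}},\qquad T^*=\frac1{\eta\lambda_T^*}.$$ The following holds. (a) If $T^*$ is an integer, then for $T=T^*$ the bound $$\mathrm{Risk}(\theta_T)-\min_{\theta\in\Delta_d:\,D_{\mathrm{KL}}(\theta,u)\le b}\mathrm{Risk}(\theta)\le2\sigma\sqrt{\frac{b(\log(2d)+\delta)}{n}}$$ holds with probability at least $1-e^{-\delta}$ in cases 1 and 2, and at least $1-e^{-\delta}-1/n$ in case 3 provided that $\delta\ge1$ and $n\ge3$. (b) If $T^*$ is not an integer, then for $T=\lceil T^*\rceil$ the bound in (a) holds (with the same probabilities and provisos) with the additional additive term $e_T=\eta\sigma^2(\log(2d)+\delta)/n$ on the right-hand side.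
   Context: $\Delta_d=\{a\in\mathbb{R}^d:a_i\ge0,\ \sum_{i=1}^da_i=1\}$; $D_{\mathrm{KL}}(a,b)=\sum_{i=1}^da_i\log(a_i/b_i)$ (with the usual conventions $0\log 0=0$, and value $+\infty$ if $a_i>0=b_i$ for some $i$); $\odot$ is coordinatewise multiplication and $\exp$ acts coordinatewise. $Y=(Y_1,\dots,Y_n)$. The prediction risk of an estimator $\hat\theta=\hat\theta(X,Y)$ is $\mathrm{Risk}(\hat\theta)=\frac1n\mathbb{E}\big[-(Y^* )^\top X\hat\theta+\sum_{i=1}^nA(x_i^\top\hat\theta)\,\big|\,Y\big]=\frac1n\big(-\mu^\top X\hat\theta+\sum_{i=1}^nA(x_i^\top\hat\theta)\big)$, where $Y^*$ is an independent copy of $Y$. No model for $\mu_i$ in terms of $x_i$ is assumed. $f$ is $L$-smooth on $\Delta_d$ with respect to $\|\cdot\|_1$ if $\|\nabla f(x)-\nabla f(y)\|_\infty\le L\|x-y\|_1$ for $x,y\in\Delta_d$. *)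

(* Defs.v *)
From HB Require Import structures.
From mathcomp Require Export all_boot all_order all_algebra.
From mathcomp Require Export all_classical all_reals all_analysis.
Export Order.TTheory GRing.Theory Num.Theory.
Export numFieldNormedType.Exports.

Set Implicit Arguments.
Unset Strict Implicit.
Unset Printing Implicit Defensive.

Local Open Scope classical_set_scope.
Local Open Scope ring_scope.

(* Vectors are columns.  The canonical norm `|v| of the library on matrices is
   the entrywise sup norm; it serves as the norm with index infinity below. *)

Section Vectors.
Context {R : realType}.

Definition l1norm d (v : 'cV[R]_d) : R := \sum_(j < d) `|v j 0|.

Definition l2norm d (v : 'cV[R]_d) : R := Num.sqrt (\sum_(j < d) v j 0 ^+ 2).

Definition simplex d : set 'cV[R]_d :=
  [set a | (forall j, 0 <= a j 0) /\ \sum_(j < d) a j 0 = 1].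

Definition KL d (a b : 'cV[R]_d) : \bar R :=
  (\sum_(i < d)
     if (a i 0 == 0)%R then 0
     else if (b i 0 == 0)%R then +oo
     else (a i 0 * ln (a i 0 / b i 0))%R%:E)%E.

Definition gradient d (f : 'cV[R]_d -> R) (x : 'cV[R]_d) : 'cV[R]_d :=
  \col_(j < d) 'D_(delta_mx j 0) f x.

Definition l1_smooth d (L : R) (D : set 'cV[R]_d) (f : 'cV[R]_d -> R) : Prop :=
  (forall x, D x -> differentiable f x) /\
  (forall x y, D x -> D y ->
     `|gradient f x - gradient f y| <= L * l1norm (x - y)).

Definition egd_step d (eta : R) (f : 'cV[R]_d -> R) (theta : 'cV[R]_d) :
    'cV[R]_d :=
  let theta' := \col_(j < d) (theta j 0 * expR (- eta * gradient f theta j 0))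
  in (l1norm theta')^-1 *: theta'.

Definition egd d (eta : R) (f : 'cV[R]_d -> R) (u : 'cV[R]_d) (t : nat) :
    'cV[R]_d :=
  iter t (egd_step eta f) u.

Definition is_minimum (S : set R) (m : R) : Prop := S m /\ lbound S m.

End Vectors.

Section Probability.
Context {R : realType} {disp : measure_display} {Om : measurableType disp}.

Definition mutually_independent (P : probability Om R) n
    (Y : 'I_n -> {RV P >-> R}) : Prop :=
  forall (J : {set 'I_n}) (B : 'I_n -> set R), (forall i, measurable (B i)) ->
    P (\bigcap_(i in [set` J]) (Y i @^-1` B i)) =
    (\prod_(i in J) P (Y i @^-1` B i))%E.

Definition holds_with_prob_ge (P : probability Om R) (p : R) (E : set Om) :
    Prop :=
  measurable E /\ (p%:E <= P E)%E.

Definition response (P : probability Om R) n (Y : 'I_n -> {RV P >-> R})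
    (w : Om) : 'cV[R]_n :=
  \col_i Y i w.

End Probability.

Section GLM.
Context {R : realType}.

(* The argument of [Gaussian] lists the standard deviations of the responses. *)
Inductive glm_case (n : nat) : Type :=
| Gaussian of 'I_n -> R
| Bernoulli
| Poisson.

(* The library's [normal_prob m s] is not the Dirac mass at m when s = 0.  The
   second argument of [poisson_prob] is a dummy. *)
Definition response_law n (c : glm_case n) (mu : 'cV[R]_n) (i : 'I_n) :
    set R -> \bar R :=
  match c with
  | Gaussian s =>
      if s i == 0 then \d_(mu i 0) else normal_prob (mu i 0) (s i)
  | Bernoulli => pushforward (bernoulli_prob (mu i 0)) (fun k : bool => k%:R : R)
  | Poisson => pushforward (poisson_prob (mu i 0) 0%N) (fun k : nat => k%:R : R)
  end.

Definition valid_params n (c : glm_case n) (mu : 'cV[R]_n) : Prop :=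
  match c with
  | Gaussian s => forall i, 0 <= s i
  | Bernoulli => forall i, 0 <= mu i 0 <= 1
  | Poisson => forall i, 0 <= mu i 0
  end.

Definition log_partition n (c : glm_case n) (v : R) : R :=
  match c with
  | Gaussian _ => v ^+ 2 / 2
  | Bernoulli => ln (1 + expR v)
  | Poisson => expR v
  end.

Definition noise_level n (c : glm_case n) (mu : 'cV[R]_n) : R :=
  match c with
  | Gaussian s => \big[Num.max/0]_(i < n) s i
  | Bernoulli => 2^-1
  | Poisson => (6 * `|mu| + 2) * ln n%:R + 3 * Num.sqrt `|mu|
  end.

Definition smoothness_const n d (c : glm_case n) (X : 'M[R]_(n, d)) : R :=
  match c with
  | Gaussian _ => n%:R^-1 * \sum_(i < n) `|row i X| ^+ 2
  | Bernoulli => (4 * n%:R)^-1 * \sum_(i < n) `|row i X| ^+ 2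
  | Poisson => n%:R^-1 * \sum_(i < n) expR `|row i X| * `|row i X| ^+ 2
  end.

Definition success_prob n (c : glm_case n) (delta : R) : R :=
  match c with
  | Poisson => 1 - expR (- delta) - n%:R^-1
  | _ => 1 - expR (- delta)
  end.

Definition proviso n (c : glm_case n) (delta : R) : Prop :=
  match c with
  | Poisson => 1 <= delta /\ (3 <= n)%N
  | _ => True
  end.

Definition neg_loglik n d (A : R -> R) (X : 'M[R]_(n, d)) (y : 'cV[R]_n)
    (theta : 'cV[R]_d) : R :=
  - (y^T *m X *m theta) 0 0 + \sum_(i < n) A ((X *m theta) i 0).

Definition empirical_loss n d (A : R -> R) (X : 'M[R]_(n, d)) (y : 'cV[R]_n)
    (theta : 'cV[R]_d) : R :=
  n%:R^-1 * neg_loglik A X y theta.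

(* The risk of an estimator is a conditional expectation given Y, over an
   independent copy Y* of Y: the estimator, being a function of Y, is frozen at
   its value theta, and Y* is averaged over the law of Y. *)
Definition prediction_risk disp (Om : measurableType disp)
    (P : probability Om R) n d (A : R -> R) (X : 'M[R]_(n, d))
    (Y : 'I_n -> {RV P >-> R}) (theta : 'cV[R]_d) : R :=
  n%:R^-1 * fine 'E_P[fun w => neg_loglik A X (response Y w) theta].

End GLM.

Arguments glm_case R n : clear implicits.

(* Main.v *)
Require Import Defs.
From mathcomp Require Import measurable_realfun ring lra.

Set Implicit Arguments.
Unset Strict Implicit.
Unset Printing Implicit Defensive.

Local Open Scope classical_set_scope.
Local Open Scope ring_scope.

(** Write [f] for the empirical loss and [F] for the prediction risk.  By
    linearity of the expectation, [F] is the loss computed with the mean vector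
    [mu] in place of the responses [y], so the two differ by a linear form:
    [F th = f th + dot g th] with the noise vector [g = X^T (y - mu) / n].

    Optimization.  Exponentiated gradient descent is mirror descent for the
    relative entropy.  One step is an exponential tilt of the current iterate,
    for which the three-point identity holds exactly.  Since [f] is convex and
    smooth for the l1 norm, and since Pinsker's inequality makes the relative
    entropy strongly convex for that norm, a step size at most [1 / L] gives
    [T eta (f th_T - f a) <= KL a u - KL a th_T] ([egd_regret]).  The term
    [KL a th_T] must not be dropped: by Pinsker it is at least half the squared
    l1 distance [D] between [a] and [th_T], and it absorbs the noise
    [dot g (th_T - a) <= r * D] when all entries of [g] are at most [r] in
    absolute value.  With [K = T eta], maximizing over [D] leaves
    [F th_T - F a <= K r^2 / 2 + b / K] ([egd_excess_risk]), and
    [K = 1 / lambda] balances the two terms ([tuned_bound]).  Rounding the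
    stopping time up to an integer increases [K] by at most [eta], which
    costs the additional term.

    Probability.  It remains to bound the entries of [g] by
    [r = sigma sqrt (2 (ln (2 d) + delta) / n)].  Each entry is a weighted sum of
    independent centered responses, so Chernoff's method and a union bound over
    the [d] columns and the two signs suffice when the moment generating function
    of every centered response is at most [exp (a^2 sigma^2 / 2)].  This holds for Gaussian
    responses by a direct computation and for Bernoulli responses by Hoeffding's
    inequality.  A Poisson variable is not subgaussian, but it becomes so when its
    generating function is restricted to the event that the variable exceeds its
    mean by at most [k = 2 ln n + |mu|]: for [a <= 1] the logarithm of the full
    centered generating function is at most quadratic in [a], and for [a > 1] the
    bound [exp (a k)] is good enough because [k <= sigma^2 / 2].  Chernoff's method
    works on these events without any recentering ([chernoff_sum]), and they all
    hold except with probability at most [1 / n].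

    The quadratic bound on the softplus function [ln (1 + exp v)], whose second
    derivative is at most [1 / 4], is used three times: for the smoothness of the
    logistic loss, for Hoeffding's inequality, and through the latter for
    Pinsker's inequality. *)

(** * Functions of one variable with bounded curvature *)

Section Curvature.
Context {R : realType}.

Lemma MVT_unordered (f df : R -> R) (a b : R) :
  (forall x : R, is_derive x 1 f (df x)) ->
  exists2 c, Num.min a b <= c <= Num.max a b & f b - f a = df c * (b - a).
Proof.
move=> fdf.
have cf (x y : R) : {within `[x, y], continuous f}.
  apply/continuous_subspaceT => z.
  by apply/differentiable_continuous/derivable1_diffP; exact: ex_derive.
have [ab|/ltW ba] := leP a b.
  have [c cab E] := MVT_segment ab (fun x _ => fdf x) (cf a b).
  by exists c.
have [c cab E] := MVT_segment ba (fun x _ => fdf x) (cf b a).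
by exists c => //; rewrite -[LHS]opprB E -mulrN opprB.
Qed.

(** A first-order form of [0 <= A'' <= C] on [D].  Only increments of the
    derivative enter the smoothness of the losses and their quadratic bounds. *)
Definition has_curvature (A dA : R -> R) (D : set R) (C : R) :=
  (forall v : R, is_derive v 1 A (dA v)) /\
  (forall v w, D v -> D w -> v <= w -> 0 <= dA w - dA v <= C * (w - v)).

Lemma has_curvature_derive2 (A dA ddA : R -> R) (D : set R) (C : R) :
  is_interval D ->
  (forall v : R, is_derive v 1 A (dA v)) ->
  (forall v : R, is_derive v 1 dA (ddA v)) ->
  (forall v, D v -> 0 <= ddA v <= C) -> has_curvature A dA D C.
Proof.
move=> itD dAP ddAP ddAC; split=> // v w Dv Dw vw.
have [c] := MVT_unordered v w ddAP.
rewrite (min_l vw) (max_r vw) => cvw ->.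
have /andP[c0 cC] := ddAC c (itD _ _ Dv Dw _ cvw).
by rewrite mulr_ge0 ?subr_ge0//= ler_wpM2r// subr_ge0.
Qed.

Lemma has_curvatureS (A dA : R -> R) (D D' : set R) (C : R) : D' `<=` D ->
  has_curvature A dA D C -> has_curvature A dA D' C.
Proof.
by move=> D'D [dAP hC]; split=> // v w /D'D Dv /D'D Dw; exact: hC.
Qed.

Section bounds.
Variables (A dA : R -> R) (D : set R) (C : R).
Hypotheses (itD : is_interval D) (AC : has_curvature A dA D C).

Lemma curvature_lipschitz v w : D v -> D w -> `|dA v - dA w| <= C * `|v - w|.
Proof.
move=> Dv Dw; have [vw|/ltW wv] := leP v w.
  have /andP[h0 h1] := AC.2 _ _ Dv Dw vw.
  by rewrite distrC ger0_norm// distrC (@ger0_norm _ (w - v)) ?subr_ge0.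
have /andP[h0 h1] := AC.2 _ _ Dw Dv wv.
by rewrite ger0_norm// ger0_norm ?subr_ge0.
Qed.

Let between v w c : D v -> D w -> Num.min v w <= c <= Num.max v w -> D c.
Proof.
move=> Dv Dw; have [vw|/ltW wv] := leP v w; first exact: itD.
exact: itD.
Qed.

Lemma curvature_below v w : D v -> D w -> A w + dA w * (v - w) <= A v.
Proof.
move=> Dv Dw; have [c cP E] := MVT_unordered w v AC.1.
have Dc := between Dw Dv cP.
rewrite -lerBrDl E -subr_ge0 -mulrBl.
move: cP; have [wv|/ltW vw] := leP w v => /andP[c1 c2].
  have /andP[h0 _] := AC.2 _ _ Dw Dc c1.
  by rewrite mulr_ge0// subr_ge0.
have /andP[h0 _] := AC.2 _ _ Dc Dw c2.
by rewrite mulr_le0// subr_le0 // -subr_ge0.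
Qed.

(** The difference of the two sides has a derivative with the sign of [v - w], so
    it is smallest at [v = w], where it vanishes. *)
Lemma curvature_above v w : D v -> D w ->
  A v <= A w + dA w * (v - w) + C / 2 * (v - w) ^+ 2.
Proof.
move=> Dv Dw.
pose f := fun z => A z - dA w * z - C / 2 * (z - w) ^+ 2.
pose df := fun z => dA z - dA w - C * (z - w).
have fdf (z : R) : is_derive z 1 f (df z).
  have := AC.1 z => Az.
  rewrite /f; apply: is_derive_eq.
  by rewrite /df /GRing.scale/=; field.
have [c cP E] := MVT_unordered w v fdf.
have Dc := between Dw Dv cP.
suff : f v - f w <= 0.
  rewrite /f subrr expr0n /= mulr0 subr0 => h.
  have -> : A v = A v - dA w * v - C / 2 * (v - w) ^+ 2 - (A w - dA w * w) +
   (A w + dA w * (v - w) + C / 2 * (v - w) ^+ 2) by ring.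
  by rewrite gerDr.
rewrite E /df; move: cP; have [wv|/ltW vw] := leP w v => /andP[c1 c2].
  have /andP[_ h] := AC.2 _ _ Dw Dc c1.
  by apply: mulr_le0_ge0; rewrite ?subr_le0 ?subr_ge0.
have /andP[_ h] := AC.2 _ _ Dc Dw c2.
apply: mulr_ge0_le0; last by rewrite subr_le0.
by rewrite subr_ge0 -lerN2 -mulrN !opprB.
Qed.

End bounds.

Lemma curvature_sqr (D : set R) :
  has_curvature (fun v : R => v ^+ 2 / 2) id D 1.
Proof.
split=> [v|v w _ _ vw]; last by rewrite mul1r lexx subr_ge0 vw.
by apply: is_derive_eq; rewrite /GRing.scale/= mulr1; field.
Qed.

Lemma curvature_expR (B : R) :
  has_curvature (@expR R) expR [set v | v <= B] (expR B).
Proof.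
apply: (@has_curvature_derive2 _ _ expR) => [v w _ /= wB z /andP[_ zw]|v /= vB].
  exact: le_trans zw wB.
by rewrite expR_ge0 ler_expR.
Qed.

Definition softplus (v : R) := ln (1 + expR v).
Definition logistic (v : R) := expR v / (1 + expR v).

Lemma addr1_expR_gt0 (v : R) : 0 < 1 + expR v.
Proof. by rewrite addr_gt0// expR_gt0. Qed.

Lemma is_derive_softplus (v : R) : is_derive v 1 softplus (logistic v).
Proof.
have h : is_derive v 1 (fun x : R => 1 + expR x) (expR v).
  by apply: is_derive_eq; rewrite add0r mul1r.
have := @is_derive1_comp R (@ln R) _ v _ _ (is_derive1_ln (addr1_expR_gt0 v)) h.
by rewrite mulrC.
Qed.

Lemma is_derive_logistic (v : R) :
  is_derive v 1 logistic (logistic v * (1 - logistic v)).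
Proof.
have h : is_derive v 1 (fun x : R => 1 + expR x) (expR v).
  by apply: is_derive_eq; rewrite add0r mul1r.
have n0 : 1 + expR v != 0 by rewrite gt_eqF// addr1_expR_gt0.
have h2 := @is_deriveV R (fun x => 1 + expR x) v (expR v) 1 n0 h.
have h3 := @is_deriveM R _ expR _ v 1 _ _ (is_derive_expR v) h2.
apply: (is_derive_eq h3); rewrite /logistic /GRing.scale/=; field.
by [].
Qed.

Lemma curvature_softplus : has_curvature softplus logistic setT 4^-1.
Proof.
have itT : is_interval [set: R] by [].
apply: (has_curvature_derive2 itT is_derive_softplus is_derive_logistic) => v _.
  have l0 : 0 <= logistic v.
    by rewrite divr_ge0// ?expR_ge0// ltW// addr1_expR_gt0.
  have l1 : logistic v <= 1.
    by rewrite ler_pdivrMr ?addr1_expR_gt0// mul1r lerDr.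
  rewrite mulr_ge0 ?subr_ge0//=.
  have : 0 <= (logistic v - 2^-1) ^+ 2 by exact: sqr_ge0.
  by move=> h; nra.
Qed.

(** Hoeffding's inequality for a Bernoulli variable.  Up to the additive constant
    [ln (1 - p)], the logarithm of the left-hand side is the softplus function
    shifted by the log-odds [c] of [p], where its slope is [p]. *)
Lemma hoeffding_mgf (p a : R) : 0 <= p <= 1 ->
  p * expR a + (1 - p) <= expR (p * a + a ^+ 2 / 8).
Proof.
move=> /andP[p0 p1].
have [->|pn0] := eqVneq p 0.
  by rewrite mul0r !add0r subr0 mul0r add0r -expR0 ler_expR divr_ge0// sqr_ge0.
have [->|pn1] := eqVneq p 1.
  by rewrite subrr addr0 !mul1r ler_expR lerDl divr_ge0// sqr_ge0.
have {pn0}p0' : 0 < p by rewrite lt_neqAle eq_sym pn0.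
have {pn1}p1' : 0 < 1 - p by rewrite subr_gt0 lt_neqAle pn1.
have q0 : 1 - p != 0 by rewrite gt_eqF.
have [c ec] : exists c, expR c = p / (1 - p).
  by exists (ln (p / (1 - p))); rewrite lnK// posrE divr_gt0.
have itT : is_interval [set: R] by [].
have := @curvature_above _ _ _ _ itT curvature_softplus (a + c) c I I.
have -> : logistic c = p.
  have e1 : 1 + expR c = (1 - p)^-1 by rewrite ec; field.
  by rewrite /logistic e1 ec; field.
rewrite addrK -ler_expR !expRD /softplus !lnK ?posrE ?addr1_expR_gt0//.
rewrite expRD ec => h.
have -> : p * expR a + (1 - p) = (1 - p) * (1 + expR a * (p / (1 - p))).
  by field.
have -> : a ^+ 2 / 8 = 4^-1 / 2 * a ^+ 2 by field.
rewrite -(ler_pM2l p1') in h; apply: le_trans h _.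
by rewrite !mulrA le_eqVlt; apply/orP; left; apply/eqP; field.
Qed.

End Curvature.

(** * Relative entropy on the simplex *)

Section RelativeEntropy.
Context {R : realType} {d : nat}.
Implicit Types a b s th u : 'cV[R]_d.

Definition dot a b : R := \sum_(j < d) a j 0 * b j 0.

Lemma dotDr a b s : dot a (b + s) = dot a b + dot a s.
Proof. by rewrite /dot -big_split/=; apply: eq_bigr => j _; rewrite mxE mulrDr. Qed.

Lemma dotNr a b : dot a (- b) = - dot a b.
Proof. by rewrite /dot -sumrN; apply: eq_bigr => j _; rewrite mxE mulrN. Qed.

Lemma dotBr a b s : dot a (b - s) = dot a b - dot a s.
Proof. by rewrite dotDr dotNr. Qed.

Lemma dotZl (k : R) a b : dot (k *: a) b = k * dot a b.
Proof. by rewrite /dot mulr_sumr; apply: eq_bigr => j _; rewrite mxE mulrA. Qed.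

(** As [ln 0 = 0], this real sum is the relative entropy only when the support of
    [a] lies in that of [b]; see [dominated] and [KL_dominated]. *)
Definition rel_entropy a b : R := \sum_(j < d) a j 0 * ln (a j 0 / b j 0).

Definition dominated a b := forall j, b j 0 = 0 -> a j 0 = 0.

Lemma entropy_term_ge (x y : R) : 0 <= x -> 0 <= y -> (y = 0 -> x = 0) ->
  x - y <= x * ln (x / y).
Proof.
move=> x0 y0 yx; have [->|xn0] := eqVneq x 0; first by rewrite mul0r sub0r oppr_le0.
have {}x0 : 0 < x by rewrite lt_neqAle eq_sym xn0.
have {}y0 : 0 < y.
  by rewrite lt_neqAle y0 andbT eq_sym; apply: contra_neq xn0.
have /le_ln1Dx : -1 < y / x - 1 by rewrite ltrBrDl subrr divr_gt0.
rewrite addrC subrK -[X in ln X]invf_div lnV ?posrE ?divr_gt0// => h.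
rewrite -(ler_pM2l x0) in h.
rewrite -lerN2 -mulrN; apply: le_trans h _.
by rewrite mulrBr mulrCA divff// !mulr1 opprB.
Qed.

Lemma rel_entropy_ge0 a b : simplex a -> simplex b -> dominated a b ->
  0 <= rel_entropy a b.
Proof.
move=> [a0 a1] [b0 b1] ab.
have -> : 0 = \sum_(j < d) (a j 0 - b j 0) by rewrite sumrB a1 b1 subrr.
by apply: ler_sum => j _; exact: entropy_term_ge (ab j).
Qed.

Lemma rel_entropyxx th : rel_entropy th th = 0.
Proof.
apply: big1 => j _; have [->|h] := eqVneq (th j 0) 0; first by rewrite mul0r.
by rewrite divff// ln1 mulr0.
Qed.

Definition tilt_mass b s : R := \sum_(j < d) b j 0 * expR (s j 0).

(** The exponential tilt (Gibbs measure) of [b] by [s]; a step of exponentiated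
    gradient descent tilts the iterate by [- eta] times the gradient. *)
Definition tilt b s : 'cV[R]_d :=
  \col_j (b j 0 * expR (s j 0) / tilt_mass b s).

Lemma tilt_mass_gt0 b s : simplex b -> 0 < tilt_mass b s.
Proof.
move=> [b0 b1]; rewrite lt_neqAle eq_sym; apply/andP; split; last first.
  by apply: sumr_ge0 => j _; rewrite mulr_ge0// expR_ge0.
apply/eqP => /eqP; rewrite psumr_eq0 => [|j _]; last first.
  by rewrite mulr_ge0// expR_ge0.
move=> /allP h.
suff : \sum_(j < d) b j 0 = 0 by rewrite b1 => /eqP; rewrite oner_eq0.
apply: big1 => j _; have := h j; rewrite mem_index_enum => /(_ isT) /=.
by rewrite mulf_eq0 expR_eq0 orbF => /eqP.
Qed.

Lemma tilt_simplex b s : simplex b -> simplex (tilt b s).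
Proof.
move=> sb; have Z0 := tilt_mass_gt0 s sb; split=> [j|].
  by rewrite mxE divr_ge0 ?mulr_ge0 ?expR_ge0 ?(ltW Z0)//; exact: sb.1.
under eq_bigr do rewrite mxE.
by rewrite -mulr_suml divff// gt_eqF.
Qed.

Lemma tilt_eq0 b s j : simplex b -> (tilt b s j 0 == 0) = (b j 0 == 0).
Proof.
move=> sb; have Z0 := tilt_mass_gt0 s sb.
by rewrite mxE !mulf_eq0 invr_eq0 expR_eq0 (gt_eqF Z0) !orbF.
Qed.

Lemma dominated_tiltr a b s : simplex b -> dominated a b ->
  dominated a (tilt b s).
Proof. by move=> sb ab j /eqP; rewrite tilt_eq0// => /eqP /ab. Qed.

(** The three-point identity of mirror descent: tilting changes the relative
    entropy by an affine function of [a]. *)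
Lemma rel_entropy_tilt a b s : simplex a -> simplex b -> dominated a b ->
  rel_entropy a (tilt b s) = rel_entropy a b - dot s a + ln (tilt_mass b s).
Proof.
move=> [a0 a1] sb ab; have Z0 := tilt_mass_gt0 s sb.
rewrite -[ln _]mul1r -a1 mulr_suml /rel_entropy /dot -sumrB -big_split/=.
apply: eq_bigr => j _.
have [->|aj] := eqVneq (a j 0) 0; first by rewrite !(mul0r, mulr0) subr0 addr0.
have {}aj : 0 < a j 0 by rewrite lt_neqAle eq_sym aj a0.
have bj : 0 < b j 0.
  rewrite lt_neqAle sb.1 andbT eq_sym; apply/eqP => /ab aj0.
  by rewrite aj0 ltxx in aj.
rewrite mxE invfM invrK mulrA invfM mulrA.
rewrite lnM ?posrE ?divr_gt0 ?expR_gt0 // lnM ?posrE ?invr_gt0 ?divr_gt0 ?expR_gt0 //.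
by rewrite lnV ?posrE ?expR_gt0// expRK; ring.
Qed.

(** The Donsker--Varadhan inequality: the relative entropy of [a] with respect to
    the tilt of [b] is nonnegative. *)
Lemma rel_entropy_variational a b s : simplex a -> simplex b -> dominated a b ->
  dot s a - ln (tilt_mass b s) <= rel_entropy a b.
Proof.
move=> sa sb ab.
have := rel_entropy_ge0 sa (@tilt_simplex b s sb) (@dominated_tiltr a b s sb ab).
by rewrite rel_entropy_tilt// => h; lra.
Qed.

Lemma l1norm_ge0 a : 0 <= l1norm a.
Proof. by apply: sumr_ge0 => j _. Qed.

(** Pinsker's inequality, by duality: in the variational inequality, [s] takes
    the value [l] where [b <= a] and [- l] elsewhere.  Under [b] this is a
    two-valued variable, whose log-moment is bounded by Hoeffding's inequality. *)
Lemma pinsker a b : simplex a -> simplex b -> dominated a b ->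
  l1norm (a - b) ^+ 2 / 2 <= rel_entropy a b.
Proof.
move=> sa sb ab; set l := l1norm (a - b).
pose s : 'cV[R]_d := \col_j (if b j 0 <= a j 0 then l else - l).
apply: le_trans (rel_entropy_variational s sa sb ab).
pose mass (c : 'cV[R]_d) := \sum_(j < d | b j 0 <= a j 0) c j 0.
have massC (c : 'cV[R]_d) : \sum_j c j 0 = 1 ->
    \sum_(j < d | ~~ (b j 0 <= a j 0)) c j 0 = 1 - mass c.
  move=> <-; rewrite [X in _ = X - _](bigID (fun j => b j 0 <= a j 0))/=.
  by rewrite addrAC subrr add0r.
have lE : l = 2 * (mass a - mass b).
  rewrite /l /l1norm (bigID (fun j => b j 0 <= a j 0))/=.
  have -> : \sum_(j < d | b j 0 <= a j 0) `|(a - b) j 0| = mass a - mass b.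
    by rewrite -sumrB; apply: eq_bigr => j h; rewrite !mxE ger0_norm// subr_ge0.
  have -> : \sum_(j < d | ~~ (b j 0 <= a j 0)) `|(a - b) j 0| =
      (1 - mass b) - (1 - mass a).
    rewrite -(massC _ sa.2) -(massC _ sb.2) -sumrB; apply: eq_bigr => j.
    by rewrite -ltNge => /ltW h; rewrite !mxE ler0_norm ?subr_le0// opprB.
  by ring.
have dotE : dot s a = l * (2 * mass a - 1).
  rewrite /dot (bigID (fun j => b j 0 <= a j 0))/=.
  rewrite (eq_bigr (fun j => l * a j 0)); last by move=> j h; rewrite mxE h.
  rewrite [X in _ + X](eq_bigr (fun j => - l * a j 0)); last first.
    by move=> j h; rewrite mxE (negbTE h).
  by rewrite -!mulr_sumr (massC _ sa.2) -/(mass a); ring.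
have massE : tilt_mass b s = expR (- l) * (mass b * expR (2 * l) + (1 - mass b)).
  rewrite /tilt_mass (bigID (fun j => b j 0 <= a j 0))/=.
  rewrite (eq_bigr (fun j => b j 0 * expR l)); last by move=> j h; rewrite mxE h.
  rewrite [X in _ + X](eq_bigr (fun j => b j 0 * expR (- l))); last first.
    by move=> j h; rewrite mxE (negbTE h).
  rewrite -!mulr_suml (massC _ sb.2) -/(mass b) mulrDr mulrCA -expRD.
  by rewrite (_ : - l + 2 * l = l); [rewrite (mulrC (expR _)) | ring].
have mb : 0 <= mass b <= 1.
  rewrite sumr_ge0 /=; last by move=> j _; exact: sb.1.
  rewrite -subr_ge0 -(massC _ sb.2).
  by apply: sumr_ge0 => j _; exact: sb.1.
have lnZ : ln (tilt_mass b s) <= - l + (mass b * (2 * l) + (2 * l) ^+ 2 / 8).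
  rewrite -ler_expR lnK ?posrE ?tilt_mass_gt0// massE expRD.
  by rewrite ler_pM2l ?expR_gt0//; exact: hoeffding_mgf.
rewrite dotE.
have -> : l ^+ 2 / 2 = l * (2 * mass a - 1) -
   (- l + (mass b * (2 * l) + (2 * l) ^+ 2 / 8)).
  have -> : l * (2 * mass a - 1) - (- l + (mass b * (2 * l) + (2 * l) ^+ 2 / 8))
    = l * (2 * (mass a - mass b)) - l ^+ 2 / 2 by field.
  by rewrite -lE; field.
by rewrite lerD2l lerN2.
Qed.

Lemma KL_dominated a b : dominated a b -> KL a b = (rel_entropy a b)%:E.
Proof.
move=> ab; rewrite /KL /rel_entropy -sumEFin; apply: eq_bigr => j _.
have [->|aj] := eqVneq (a j 0) 0; first by rewrite mul0r.
by have [/ab aj0|//] := eqVneq (b j 0) 0; rewrite aj0 eqxx in aj.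
Qed.

Lemma KL_lty_dominated a b : (KL a b < +oo)%E -> dominated a b.
Proof.
move=> h j bj; apply/eqP/negP => /negP aj; move: h.
suff -> : KL a b = +oo%E by rewrite ltxx.
apply/eqP; rewrite /KL esum_eqy; last first.
  move=> i _; case: ifP => _ //; by case: ifP.
by apply/existsP; exists j; rewrite (negbTE aj) bj eqxx.
Qed.

End RelativeEntropy.

(** * Exponentiated gradient descent *)

Section ExponentiatedGradient.
Context {R : realType} {d : nat}.
Variables (f : 'cV[R]_d -> R) (L eta : R).
Hypotheses (eta0 : 0 < eta) (etaL : eta * L <= 1).
Hypothesis f_below : forall x y, simplex x -> simplex y ->
  f x + dot (gradient f x) (y - x) <= f y.
Hypothesis f_above : forall x y, simplex x -> simplex y ->
  f y <= f x + dot (gradient f x) (y - x) + L / 2 * l1norm (y - x) ^+ 2.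

Lemma egd_step_tilt th : simplex th ->
  egd_step eta f th = tilt th (- eta *: gradient f th).
Proof.
move=> sth; apply/colP => j; rewrite !mxE mulrC; congr (_ * _).
congr (_^-1); apply: eq_bigr => k _; rewrite !mxE ger0_norm//.
by rewrite mulr_ge0 ?expR_ge0//; exact: sth.1.
Qed.

Lemma egd_simplex u t : simplex u -> simplex (egd eta f u t).
Proof.
move=> su; elim: t => [//|t IH]; rewrite /egd iterS -/(egd _ _ _ _).
by rewrite egd_step_tilt//; exact: tilt_simplex.
Qed.

Lemma egd_dominated a u t : simplex u -> dominated a u ->
  dominated a (egd eta f u t).
Proof.
move=> su au; elim: t => [//|t IH]; rewrite /egd iterS -/(egd _ _ _ _).
rewrite egd_step_tilt; last exact: egd_simplex.
by apply: dominated_tiltr => //; exact: egd_simplex.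
Qed.

(** Convexity compares [f th] with [f a], smoothness compares [f] at the next
    iterate with [f th], and the two linear terms add up to one evaluated by the
    three-point identity.  Pinsker's inequality and [eta * L <= 1] then make the
    entropy between consecutive iterates pay for the quadratic term. *)
Lemma egd_step_le a th : simplex a -> simplex th -> dominated a th ->
  eta * (f (egd_step eta f th) - f a) <=
  rel_entropy a th - rel_entropy a (egd_step eta f th).
Proof.
move=> sa sth ath; rewrite egd_step_tilt//.
set s := - eta *: gradient f th; set th' := tilt th s.
have sth' : simplex th' by exact: tilt_simplex.
have th'th : dominated th' th.
  by move=> j /eqP h; apply/eqP; rewrite tilt_eq0.
have E1 := rel_entropy_tilt s sth' sth th'th.
rewrite -/th' rel_entropyxx in E1.
have E2 := rel_entropy_tilt s sa sth ath.
rewrite -/th' in E2.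
have P := pinsker sth' sth th'th.
have B := f_below sth sa.
have A := f_above sth sth'.
rewrite E2.
move: E1; rewrite /s !dotZl => E1.
rewrite !dotBr in A B.
set g := gradient f th in A B E1 *.
have Q : eta * (L / 2 * l1norm (th' - th) ^+ 2) <= rel_entropy th' th.
  apply: le_trans P; rewrite mulrA mulrA mulrAC ler_pdivlMr // divfK //.
  by rewrite ler_piMl// sqr_ge0.
have : eta * (f th' - f a) <=
   eta * (dot g th' - dot g a + L / 2 * l1norm (th' - th) ^+ 2).
  by rewrite ler_pM2l//; lra.
move=> h; apply: le_trans h _; rewrite mulrDr; lra.
Qed.

Lemma egd_step_nincr th : simplex th -> f (egd_step eta f th) <= f th.
Proof.
move=> sth; have := @egd_step_le th th sth sth (fun _ h => h).
rewrite rel_entropyxx sub0r => h; rewrite -subr_le0 -(pmulr_rle0 _ eta0).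
apply: le_trans h _; rewrite oppr_le0; apply: rel_entropy_ge0 => //.
  by rewrite egd_step_tilt//; exact: tilt_simplex.
by rewrite egd_step_tilt//; exact: dominated_tiltr.
Qed.

(** The one-step bounds telescope.  As the loss does not increase along the
    iterates, the last iterate is as good as their average. *)
Lemma egd_regret a u T : simplex a -> simplex u -> dominated a u ->
  T%:R * eta * (f (egd eta f u T) - f a) <=
  rel_entropy a u - rel_entropy a (egd eta f u T).
Proof.
move=> sa su au; elim: T => [|T IH]; first by rewrite !mul0r subrr.
have st := egd_simplex T su; have dt := egd_dominated (t := T) su au.
rewrite /egd iterS -/(egd _ _ _ _).
have h1 := egd_step_le sa st dt.
have h2 : T%:R * eta * (f (egd_step eta f (egd eta f u T)) - f a) <=
   T%:R * eta * (f (egd eta f u T) - f a).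
  apply: ler_wpM2l; first by rewrite mulr_ge0 ?ler0n ?(ltW eta0).
  by rewrite lerD2r; exact: egd_step_nincr.
by rewrite -natr1 mulrDl mulrDl mul1r; lra.
Qed.

End ExponentiatedGradient.

(** * Losses of generalized linear models *)

Section LinearPredictor.
Context {R : realType} {n d : nat}.
Implicit Types (X : 'M[R]_(n, d)) (v th : 'cV[R]_d) (y : 'cV[R]_n).

Lemma le_mx_norm m k (M : 'M[R]_(m, k)) i j : `|M i j| <= `|M|.
Proof.
rewrite [leRHS]/Num.norm/= mx_normrE.
exact: (le_bigmax _ (fun ij => `|M ij.1 ij.2|) (i, j)).
Qed.

Lemma mx_norm_le m k (M : 'M[R]_(m, k)) (r : R) : 0 <= r ->
  (forall i j, `|M i j| <= r) -> `|M| <= r.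
Proof.
move=> r0 Mr; rewrite [leLHS]/Num.norm/= mx_normrE.
by apply/bigmax_leP; split=> // -[i j] _; exact: Mr.
Qed.

Lemma mulmx_cVE X v i : (X *m v) i 0 = \sum_(j < d) X i j * v j 0.
Proof. by rewrite mxE. Qed.

Lemma predictor_le X v i : `|(X *m v) i 0| <= `|row i X| * l1norm v.
Proof.
rewrite mulmx_cVE (le_trans (ler_norm_sum _ _ _))// mulr_sumr.
apply: ler_sum => j _; rewrite normrM ler_wpM2r//.
by have := le_mx_norm (row i X) 0 j; rewrite mxE.
Qed.

Lemma l1norm_simplex th : simplex th -> l1norm th = 1.
Proof.
by move=> [th0 <-]; apply: eq_bigr => j _; rewrite ger0_norm.
Qed.

Lemma predictor_simplex_le X th i : simplex th ->
  `|(X *m th) i 0| <= `|row i X|.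
Proof.
by move=> sth; have := predictor_le X th i; rewrite l1norm_simplex// mulr1.
Qed.

Lemma predictorB X v th i :
  (X *m (v - th)) i 0 = (X *m v) i 0 - (X *m th) i 0.
Proof. by rewrite mulmxBr !mxE. Qed.

Lemma dot_predictor X v y : (y^T *m X *m v) 0 0 = \sum_(i < n) y i 0 * (X *m v) i 0.
Proof. by rewrite -mulmxA !mxE; apply: eq_bigr => i _; rewrite mxE. Qed.

Lemma differentiable_predictor X i th :
  differentiable (fun v : 'cV[R]_d => (X *m v) i 0) th.
Proof.
have -> : (fun v : 'cV[R]_d => (X *m v) i 0) =
    \sum_(j < d) (X i j *: (fun v : 'cV[R]_d => v j 0)).
  by apply/funext => v; rewrite mulmx_cVE fct_sumE.
apply: differentiable_sum => j; apply: differentiableZ.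
exact: differentiable_coord.
Qed.

End LinearPredictor.

Section Loss.
Context {R : realType} {n d : nat}.
Variables (A dA : R -> R) (X : 'M[R]_(n, d)) (C : 'I_n -> R).
Hypothesis AC : forall i,
  has_curvature A dA [set v | `|v| <= `|row i X|] (C i).
Hypothesis dAP : forall v : R, is_derive v 1 A (dA v).
Hypothesis C0 : forall i, 0 <= C i.

Local Notation L := (n%:R^-1 * \sum_(i < n) C i * `|row i X| ^+ 2).

Lemma empirical_lossE y th : empirical_loss A X y th =
  n%:R^-1 * \sum_(i < n) (A ((X *m th) i 0) - y i 0 * (X *m th) i 0).
Proof.
by rewrite /empirical_loss /neg_loglik dot_predictor sumrB addrC.
Qed.

(** The vector [X^T r / n]: both the gradient of the loss and the noise vector
    have this form. *)
Definition pullback (r : 'I_n -> R) : 'cV[R]_d :=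
  \col_j (n%:R^-1 * \sum_(i < n) r i * X i j).

Lemma dot_pullback (r : 'I_n -> R) v :
  dot (pullback r) v = n%:R^-1 * \sum_(i < n) r i * (X *m v) i 0.
Proof.
rewrite /dot mulr_sumr.
under eq_bigr do rewrite mxE -mulrA mulr_suml mulr_sumr.
rewrite exchange_big/=; apply: eq_bigr => i _.
by rewrite mulmx_cVE !mulr_sumr; apply: eq_bigr => j _; rewrite !mulrA.
Qed.

Definition loss_gradient (y : 'cV[R]_n) (th : 'cV[R]_d) : 'cV[R]_d :=
  pullback (fun i => dA ((X *m th) i 0) - y i 0).

Lemma differentiable_loss y th : differentiable (empirical_loss A X y) th.
Proof.
have -> : empirical_loss A X y = (n%:R^-1 *: \sum_(i < n)
   ((A \o (fun v : 'cV[R]_d => (X *m v) i 0)) -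
     y i 0 *: (fun v : 'cV[R]_d => (X *m v) i 0))).
  apply/funext => v; rewrite empirical_lossE /= -[in RHS]/(_ * _); congr (_ * _).
  by rewrite fct_sumE.
apply/differentiableZ/differentiable_sum => i; apply: differentiableB.
  apply: differentiable_comp; first exact: differentiable_predictor.
  by apply/derivable1_diffP; exact: ex_derive.
by apply: differentiableZ; exact: differentiable_predictor.
Qed.

(** A directional derivative is the derivative at [0] of the loss along a line,
    on which every linear predictor is affine. *)
Lemma gradient_loss y th : gradient (empirical_loss A X y) th = loss_gradient y th.
Proof.
apply/colP => j; rewrite !mxE; set v := delta_mx j 0.
have -> : 'D_v (empirical_loss A X y) th =
   'D_1 (fun h : R => empirical_loss A X y (h *: v + th)) 0.
  rewrite /derive; set g1 := fun h => h^-1 *: _; set g2 := fun h => h^-1 *: _.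
  suff -> : g1 = g2 by [].
  by apply/funext => h; rewrite /g1 /g2 /= addr0 scale0r add0r [_%:A]mulr1.
have vE i h : (X *m (h *: v + th)) i 0 = h * X i j + (X *m th) i 0.
  rewrite mulmxDr -scalemxAr !mxE; congr (_ * _ + _).
  rewrite (bigD1 j)//= !mxE !eqxx mulr1 big1 ?addr0// => k kj.
  by rewrite mxE (negbTE kj) mulr0.
have -> : (fun h : R => empirical_loss A X y (h *: v + th)) =
   n%:R^-1 *: (\sum_(i < n) (fun h : R => A (h * X i j + (X *m th) i 0) -
     y i 0 * (h * X i j + (X *m th) i 0))).
  apply/funext => h; rewrite empirical_lossE -[in RHS]/(_ * _); congr (_ * _).
  rewrite fct_sumE; apply: eq_bigr => i _.
  by rewrite !vE.
have aff i : is_derive (0 : R) 1 (fun h : R => h * X i j + (X *m th) i 0) (X i j).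
  by apply: is_derive_eq; rewrite /GRing.scale/=; ring.
have D1 i : is_derive (0 : R) 1 (fun h : R => A (h * X i j + (X *m th) i 0) -
     y i 0 * (h * X i j + (X *m th) i 0))
     ((dA ((X *m th) i 0) - y i 0) * X i j).
  have h1 : is_derive (0 * X i j + (X *m th) i 0) 1 A (dA ((X *m th) i 0)).
    by rewrite mul0r add0r.
  have h2 := @is_derive1_comp R A (fun h => h * X i j + (X *m th) i 0) _ _ _ h1 (aff i).
  have h3 := is_deriveZ (y i 0) (aff i).
  apply: (is_derive_eq (is_deriveB h2 h3)).
  by rewrite /GRing.scale/= mulrBl.
have h := is_deriveZ n%:R^-1 (is_derive_sum D1).
by rewrite (@derive_val _ _ _ _ _ _ _ h).
Qed.

Let in_range i th : simplex th ->
  [set v : R | `|v| <= `|row i X|] ((X *m th) i 0).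
Proof. exact: predictor_simplex_le. Qed.

Let itv i : is_interval [set v : R | `|v| <= `|row i X|].
Proof.
move=> v w /=; rewrite !ler_norml => /andP[v1 v2] /andP[w1 w2] z /andP[vz zw].
by rewrite ler_norml (le_trans v1 vz) (le_trans zw w2).
Qed.

Lemma loss_smooth y : l1_smooth L (@simplex R d) (empirical_loss A X y).
Proof.
split=> [th _|v w sv sw]; first exact: differentiable_loss.
have L0 : 0 <= L.
  rewrite mulr_ge0 ?invr_ge0//; apply: sumr_ge0 => i _.
  by rewrite mulr_ge0.
apply: mx_norm_le => [|j k]; first by rewrite mulr_ge0 ?l1norm_ge0.
rewrite (ord1 k) !gradient_loss !mxE -mulrBr normrM ger0_norm ?invr_ge0//.
rewrite -mulrA ler_wpM2l ?invr_ge0// -sumrB.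
rewrite (le_trans (ler_norm_sum _ _ _))// mulr_suml.
apply: ler_sum => i _; rewrite -mulrBl opprB addrA subrK normrM expr2.
have h := curvature_lipschitz (AC i) (in_range i sv) (in_range i sw).
have hX : `|X i j| <= `|row i X| by have := le_mx_norm (row i X) 0 j; rewrite mxE.
apply: (@le_trans _ _ (C i * (`|row i X| * l1norm (v - w)) * `|row i X|)).
  apply: ler_pM => //; apply: le_trans h _.
  by rewrite ler_wpM2l// -predictorB predictor_le.
by rewrite le_eqVlt; apply/orP; left; apply/eqP; ring.
Qed.

Lemma loss_below y v w : simplex v -> simplex w ->
  empirical_loss A X y v +
    dot (gradient (empirical_loss A X y) v) (w - v) <= empirical_loss A X y w.
Proof.
move=> sv sw; rewrite gradient_loss dot_pullback !empirical_lossE -mulrDr.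
rewrite ler_wpM2l ?invr_ge0// -big_split/=; apply: ler_sum => i _.
have := curvature_below (@itv i) (AC i) (in_range i sw) (in_range i sv).
by rewrite predictorB => h; lra.
Qed.

Lemma loss_above y v w : simplex v -> simplex w ->
  empirical_loss A X y w <= empirical_loss A X y v +
    dot (gradient (empirical_loss A X y) v) (w - v) + L / 2 * l1norm (w - v) ^+ 2.
Proof.
move=> sv sw; rewrite gradient_loss dot_pullback !empirical_lossE.
rewrite -!mulrA -!mulrDr ler_wpM2l ?invr_ge0// mulr_suml -!big_split/=.
apply: ler_sum => i _.
have h := curvature_above (@itv i) (AC i) (in_range i sw) (in_range i sv).
have : C i / 2 * ((X *m w) i 0 - (X *m v) i 0) ^+ 2 <=
    C i / 2 * (`|row i X| * l1norm (w - v)) ^+ 2.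
  rewrite ler_wpM2l ?divr_ge0// -predictorB -real_normK ?num_real//.
  by rewrite lerXn2r ?nnegrE ?mulr_ge0 ?l1norm_ge0 ?predictor_le.
rewrite predictorB exprMn => h2; lra.
Qed.

Definition noise_gradient (y mu : 'cV[R]_n) : 'cV[R]_d :=
  pullback (fun i => y i 0 - mu i 0).

Lemma empirical_loss_diff y mu th : empirical_loss A X mu th =
  empirical_loss A X y th + dot (noise_gradient y mu) th.
Proof.
rewrite dot_pullback !empirical_lossE -mulrDr -big_split/=; congr (_ * _).
by apply: eq_bigr => i _; ring.
Qed.

Lemma dot_le_sup (g v : 'cV[R]_d) (r : R) : (forall j, `|g j 0| <= r) ->
  dot g v <= r * l1norm v.
Proof.
move=> gr; rewrite /dot /l1norm mulr_sumr; apply: ler_sum => j _.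
by rewrite (le_trans (ler_norm _))// normrM ler_wpM2r.
Qed.

(** The regret bound keeps the entropy between the comparator and the last
    iterate; by Pinsker's inequality it dominates [D^2 / 2], and
    [r D <= K r^2 / 2 + D^2 / (2 K)]. *)
Lemma egd_excess_risk (eta r b : R) (u a : 'cV[R]_d) (y mu : 'cV[R]_n) (T : nat) :
  0 < eta -> eta * L <= 1 -> simplex u -> simplex a -> dominated a u ->
  rel_entropy a u <= b -> (0 < T)%N ->
  (forall j, `|noise_gradient y mu j 0| <= r) ->
  empirical_loss A X mu (egd eta (empirical_loss A X y) u T) -
    empirical_loss A X mu a <= (T%:R * eta) * r ^+ 2 / 2 + b / (T%:R * eta).
Proof.
move=> eta0 etaL su sa au aub T0 gr.
set th := egd _ _ _ _; set K := T%:R * eta.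
have K0 : 0 < K by rewrite mulr_gt0 ?ltr0n.
have sth : simplex th by exact: egd_simplex.
have dth : dominated a th by exact: egd_dominated.
have reg : K * (empirical_loss A X y th - empirical_loss A X y a) <=
    rel_entropy a u - rel_entropy a th.
  apply: (egd_regret eta0 etaL) => //; [exact: loss_below | exact: loss_above].
have P := pinsker sa sth dth.
rewrite !(empirical_loss_diff y mu).
have hg := dot_le_sup (th - a) gr; rewrite dotBr in hg.
have sym : l1norm (a - th) = l1norm (th - a).
  by apply: eq_bigr => j _; rewrite !mxE distrC.
rewrite sym in P.
set D := l1norm (th - a) in P hg.
have amgm : 0 <= (K * r - D) ^+ 2 by exact: sqr_ge0.
rewrite -(ler_pM2l K0).
have -> : K * (K * r ^+ 2 / 2 + b / K) = (K * r) ^+ 2 / 2 + b.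
  by field; rewrite gt_eqF.
set fy := empirical_loss A X y in reg *.
set g := noise_gradient y mu in hg *.
(* After multiplication by K the claim is linear in K f, K r D, D^2 and the
   relative entropies. *)
have e1 : K * (dot g th - dot g a) <= K * (r * D) by rewrite ler_pM2l.
have e2 : K * (fy th + dot g th - (fy a + dot g a)) =
  K * (fy th - fy a) + K * (dot g th - dot g a) by ring.
rewrite e2.
have e3 : (K * r - D) ^+ 2 = (K * r) ^+ 2 - 2 * (K * (r * D)) + D ^+ 2 by ring.
rewrite e3 in amgm.
lra.
Qed.

End Loss.

(** * Minimizers over a relative-entropy ball *)

Section KLBall.
Context {R : realType} {d : nat}.
Implicit Types a b s u : 'cV[R]_d.

Definition KL_ball u (r : R) : set 'cV[R]_d :=
  [set a | simplex a /\ (KL a u <= r%:E)%E].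

Lemma KL_ballP u r a :
  KL_ball u r a <-> [/\ simplex a, dominated a u & rel_entropy a u <= r].
Proof.
split=> [[sa KLr]|[sa au ar]]; last first.
  by split=> //; rewrite (KL_dominated au) lee_fin.
have au : dominated a u by apply: KL_lty_dominated; exact: le_lt_trans KLr (ltry _).
by split=> //; rewrite -lee_fin -KL_dominated.
Qed.

(** Converse of [rel_entropy_variational], which writes a relative-entropy ball as
    an intersection of closed half-spaces and so gives lower semicontinuity. *)
Lemma rel_entropy_le_variational a u (r : R) : simplex a -> simplex u ->
  dominated a u -> (forall s, dot s a - ln (tilt_mass u s) <= r) ->
  rel_entropy a u <= r.
Proof.
move=> sa su au H; apply/ler_addgt0Pr => e e0.
(* The optimal tilt ln (a / u) would be minus infinity where a vanishes; the
   value ln e there costs at most e in the mass. *)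
pose s : 'cV[R]_d := \col_j (if a j 0 == 0 then ln e else ln (a j 0 / u j 0)).
have -> : rel_entropy a u = dot s a.
  apply: eq_bigr => j _; rewrite mxE mulrC.
  by have [->|//] := eqVneq (a j 0) 0; rewrite !mulr0.
have Z1 : tilt_mass u s <= 1 + e.
  have -> : 1 + e = \sum_(j < d) (a j 0 + e * u j 0).
    by rewrite big_split/= -mulr_sumr sa.2 su.2 mulr1.
  apply: ler_sum => j _; rewrite mxE.
  have [aj|aj] := eqVneq (a j 0) 0; first by rewrite lnK ?posrE// aj add0r mulrC.
  have {}aj : 0 < a j 0 by rewrite lt_neqAle eq_sym aj; exact: sa.1.
  have uj : 0 < u j 0.
    rewrite lt_neqAle su.1 andbT eq_sym; apply/eqP => /au aj0.
    by rewrite aj0 ltxx in aj.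
  by rewrite lnK ?posrE ?divr_gt0// mulrC divfK ?gt_eqF// lerDl mulr_ge0// ltW.
have lnZ : ln (tilt_mass u s) <= e.
  have e1 : 0 < 1 + e by rewrite addr_gt0.
  apply: le_trans (le_ln1Dx (_ : -1 < e)); last by rewrite (lt_trans _ e0)// oppr_lt0.
  by rewrite ler_ln ?posrE// tilt_mass_gt0.
by have := H s; lra.
Qed.

Lemma continuous_dot s : continuous (fun a : 'cV[R]_d => dot s a).
Proof.
have -> : (fun a : 'cV[R]_d => dot s a) = (fun a => ((s^T : 'M[R]_(1, d)) *m a) 0 0).
  by apply/funext => a; rewrite mulmx_cVE; apply: eq_bigr => j _; rewrite mxE.
by move=> a; apply: differentiable_continuous; exact: differentiable_predictor.
Qed.

Lemma closed_simplex : closed (@simplex R d).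
Proof.
have -> : @simplex R d =
    (\bigcap_(j in [set: 'I_d]) (fun a : 'cV[R]_d => a j 0) @^-1` [set x | 0 <= x]) `&`
    (fun a => dot (const_mx 1) a) @^-1` [set 1].
  have e a : dot (const_mx 1) a = \sum_(j < d) a j 0.
    by apply: eq_bigr => j _; rewrite mxE mul1r.
  apply/seteqP; split => a /=; rewrite e.
    by move=> [a0 a1]; split=> // j _; exact: a0.
  by move=> [a0 a1]; split=> // j; exact: (a0 j I).
apply: closedI.
  apply: closed_bigI => j _; apply: closed_comp; last exact: closed_ge.
  by move=> a _; exact: coord_continuous.
apply: closed_comp; last exact: closed_eq.
by move=> a _; exact: continuous_dot.
Qed.

Lemma closed_KL_ball u (r : R) : simplex u -> closed (KL_ball u r).
Proof.
move=> su.
have -> : KL_ball u r = @simplex R d `&`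
    ((\bigcap_(j in [set j : 'I_d | u j 0 = 0])
       (fun a : 'cV[R]_d => a j 0) @^-1` [set 0]) `&`
     (\bigcap_(s in [set: 'cV[R]_d])
       (fun a : 'cV[R]_d => dot s a) @^-1` [set x | x <= r + ln (tilt_mass u s)])).
  apply/seteqP; split => a.
    move=> /KL_ballP [sa au ar]; split => //; split=> [j uj|s _ /=]; first exact: au.
    by have := rel_entropy_variational s sa su au; lra.
  move=> [sa [au H]]; apply/KL_ballP; split => //.
  apply: rel_entropy_le_variational => // s; have := H s I; rewrite /=; lra.
apply: closedI; first exact: closed_simplex.
apply: closedI.
  apply: closed_bigI => j _; apply: closed_comp; last exact: closed_eq.
  by move=> a _; exact: coord_continuous.
apply: closed_bigI => s _; apply: closed_comp; last exact: closed_le.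
by move=> a _; exact: continuous_dot.
Qed.

Lemma continuous_trmx m n : continuous (@trmx R m n).
Proof.
move=> M s /= /(nbhs_ballP (M^T)) [e e0 es].
apply/nbhs_ballP; exists e => //= N [_ MN]; apply: es.
by split=> // i j; rewrite !mxE.
Qed.

(** Transposition carries the Heine--Borel theorem from row to column vectors. *)
Lemma compact_cV (S : set 'cV[R]_d) : bounded_set S -> closed S -> compact S.
Proof.
move=> bS cS.
have -> : S = @trmx R 1 d @` (@trmx R 1 d @^-1` S).
  apply/seteqP; split => [a Sa|a [v /= Sv <-//]].
  by exists a^T; rewrite /= trmxK.
apply: continuous_compact.
  by apply: continuous_subspaceT; exact: continuous_trmx.
apply: bounded_closed_compact; last first.
  by apply: closed_comp => // v _; exact: continuous_trmx.
move: bS => [M [Mr HM]]; exists M; split=> // x Mx v /= Sv.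
apply: le_trans (HM x Mx _ Sv); apply: mx_norm_le => // i j.
by have := le_mx_norm v^T j i; rewrite mxE.
Qed.

Lemma compact_KL_ball u (r : R) : simplex u -> compact (KL_ball u r).
Proof.
move=> su; apply: compact_cV; last exact: closed_KL_ball.
exists 1; split=> // x x1 a [sa _].
apply: mx_norm_le => [|j k]; first by rewrite (le_trans _ (ltW x1)).
rewrite (ord1 k); apply: le_trans (ltW x1).
rewrite ger0_norm; last exact: sa.1.
by rewrite -sa.2 (bigD1 j)//= lerDl; apply: sumr_ge0 => i _; exact: sa.1.
Qed.

Lemma KL_ball_min u (r : R) (F : 'cV[R]_d -> R) : simplex u -> 0 <= r -> continuous F ->
  exists2 a, KL_ball u r a & is_minimum (F @` KL_ball u r) (F a).
Proof.
move=> su r0 cF.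
have [|a aK amin] := compact_EVT_min _ (@compact_KL_ball u r su) (continuous_subspaceT cF).
  by exists u; apply/KL_ballP; split=> //; rewrite rel_entropyxx.
rewrite inE in aK; exists a => //; split; first by exists a.
by move=> _ [t tK <-]; apply: amin; rewrite inE.
Qed.

End KLBall.

(** * Densities and independence *)

Lemma indic_preimage (R : realType) (T T' : Type) (Y : T -> T') (B : set T') w :
  \1_B (Y w) = \1_(Y @^-1` B) w :> R.
Proof.
rewrite !indicE.
by have -> : (w \in Y @^-1` B) = (Y w \in B) by apply/idP/idP; rewrite !inE.
Qed.

Section Density.
Local Open Scope ereal_scope.
Context d d' (T : measurableType d) (T' : measurableType d') (R : realType).
Variables (m : {measure set T -> \bar R}) (nu : {measure set T' -> \bar R}).
Variables (Y : T -> T') (W : T -> R).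
Hypotheses (mY : measurable_fun setT Y) (mW : measurable_fun setT W).
Hypothesis W0 : forall x, (0 <= W x)%R.
Hypothesis nuE : forall B, measurable B ->
  nu B = \int[m]_(x in Y @^-1` B) (W x)%:E.

Import HBNNSimple.

Let density_indic B : measurable B ->
  \int[nu]_y (\1_B y)%:E = \int[m]_x ((W x)%:E * (\1_B (Y x))%:E).
Proof.
move=> mB; rewrite integral_indic// setIT nuE//.
rewrite integral_mkcond/=; apply: eq_integral => x _.
by rewrite epatch_indic/= -(@indic_preimage R _ _ Y B x).
Qed.

Let density_nnsfun (h : {nnsfun T' >-> R}) :
  \int[nu]_y (h y)%:E = \int[m]_x ((W x)%:E * (h (Y x))%:E).
Proof.
under [LHS]eq_integral do rewrite fimfunE -fsumEFin//.
rewrite [LHS]ge0_integral_fsum//; last 2 first.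
  - by move=> r; exact/measurable_EFinP/measurableT_comp.
  - by move=> n x _; rewrite EFinM nnfun_muleindic_ge0.
under [RHS]eq_integral.
  move=> x xD; rewrite fimfunE -fsumEFin// ge0_mule_fsumr; last first.
    by move=> r; rewrite EFinM nnfun_muleindic_ge0.
  over.
have mi r : measurable_fun setT (fun x => (r * \1_(h @^-1` [set r]) (Y x))%:E).
  apply/measurable_EFinP; apply: measurable_funM => //.
  apply: (measurableT_comp _ mY); exact: measurable_indic.
rewrite [RHS]ge0_integral_fsum//; last 2 first.
  - by move=> r; apply: emeasurable_funM => //; exact/measurable_EFinP.
  - by move=> n x _; rewrite mule_ge0 ?lee_fin// -lee_fin EFinM nnfun_muleindic_ge0.
apply: eq_fsbigr => r /[!inE] -[y _ hy].
have r0 : (0 <= r)%R by rewrite -hy.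
under eq_integral do rewrite EFinM.
rewrite ge0_integralZl//; last first.
  exact/measurable_EFinP/measurable_indic.
rewrite density_indic//.
under [RHS]eq_integral do rewrite EFinM muleCA.
rewrite ge0_integralZl//.
- apply: emeasurable_funM; first exact/measurable_EFinP.
  apply/measurable_EFinP/(measurableT_comp _ mY); exact: measurable_indic.
- by move=> x _; rewrite mule_ge0// lee_fin.
Qed.

(** The weight [W] and the map [Y] serve two purposes: with a weight depending on
    the other variables this is the induction step for independence, and with
    [Y] the identity or an embedding into the reals it computes moments from a
    density or a mass function. *)
Lemma integral_density (h : T' -> \bar R) : measurable_fun setT h ->
  (forall y, 0 <= h y) ->
  \int[nu]_y h y = \int[m]_x ((W x)%:E * h (Y x)).
Proof.
move=> mh h0; pose h_ := nnsfun_approx measurableT mh.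
have lim_h y : h y = limn (fun n => (h_ n y)%:E).
  by apply/esym/cvg_lim => //; apply: cvg_nnsfun_approx.
transitivity (limn (fun n => \int[nu]_y (h_ n y)%:E)).
  under eq_integral do rewrite lim_h.
  apply: monotone_convergence => //.
  - by move=> n; exact/measurable_EFinP.
  - by move=> n x _; rewrite lee_fin.
  - by move=> x _ a b ab; rewrite lee_fin//; exact/lefP/nd_nnsfun_approx.
under eq_fun do rewrite density_nnsfun.
under [RHS]eq_integral.
  move=> x _.
  have -> : (W x)%:E * h (Y x) = limn (fun n => (W x)%:E * (h_ n (Y x))%:E).
    apply/esym/cvg_lim => //; apply: cvgeZl => //.
    by apply: cvg_nnsfun_approx.
  over.
apply/esym/monotone_convergence => //.
- move=> n; apply: emeasurable_funM; first exact/measurable_EFinP.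
  by apply/measurable_EFinP/(measurableT_comp _ mY).
- by move=> n x _; rewrite mule_ge0 ?lee_fin.
- move=> x _ a b ab; rewrite lee_wpmul2l ?lee_fin//.
  exact/lefP/nd_nnsfun_approx.
Qed.

End Density.

Section Independence.
Context {R : realType} {disp : measure_display} {Om : measurableType disp}.
Variables (P : probability Om R) (n : nat) (Y : 'I_n -> {RV P >-> R}).
Hypothesis indepY : mutually_independent Y.

Let measurable_prodY (S : pred 'I_n) (h : 'I_n -> R -> R) :
  (forall i, measurable_fun setT (h i)) ->
  measurable_fun setT (fun w => \prod_(i < n | S i) h i (Y i w)).
Proof.
move=> mh.
have -> : (fun w => \prod_(i < n | S i) h i (Y i w)) =
    (fun w => \prod_(i <- [seq i <- index_enum 'I_n | S i]) h i (Y i w)).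
  by apply/funext => w; rewrite big_filter.
apply: measurable_prod => i _.
exact: (measurableT_comp (mh i)).
Qed.

(** Induction on the number [k] of factors that are arbitrary functions, the
    others being indicators; independence is the case [k = 0]. *)
Let expectation_prod_indic (k : nat) (h : 'I_n -> R -> R) (e : 'I_n -> R) :
  (forall i, measurable_fun setT (h i)) -> (forall i x, 0 <= h i x) ->
  (forall i, \int[P]_w (h i (Y i w))%:E = (e i)%:E)%E ->
  (forall i : 'I_n, (k <= i)%N -> exists2 B, measurable B & h i = \1_B) ->
  (\int[P]_w (\prod_(i < n) h i (Y i w))%:E = (\prod_(i < n) e i)%:E)%E.
Proof.
elim: k h e => [|k IH] h e mh h0 he hB.
  have /choice [B BP] : forall i, exists B, measurable B /\ h i = \1_B.
    by move=> i; have [B mB hE] := hB i (leq0n _); exists B.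
  have mB i : measurable (B i) by case: (BP i).
  have mYB i : measurable (Y i @^-1` B i).
    exact: measurable_funPTI.
  have hE i w : h i (Y i w) = \1_(Y i @^-1` B i) w.
    by rewrite (BP i).2; exact: indic_preimage.
  have eB i : (e i)%:E = P (Y i @^-1` B i).
    rewrite -he; under eq_integral do rewrite hE.
    by rewrite integral_indic// setIT.
  pose I := \bigcap_(i in [set` [set: 'I_n]%SET]) (Y i @^-1` B i).
  have mI : measurable I by apply: fin_bigcap_measurable.
  transitivity (P I).
    rewrite -[I in RHS]setIT -integral_indic//.
    apply: eq_integral => w _; congr (_%:E).
    under eq_bigr do rewrite hE indicE.
    rewrite indicE; have [wI|wI] := boolP (w \in I).
      apply: big1 => i _; rewrite mem_set//.
      by move: wI; rewrite inE => /(_ i); apply; rewrite /= finset.in_setT.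
    move: wI; rewrite notin_setE /I /bigcap/= -existsNP => -[i].
    move=> /not_implyP [_ nB]; rewrite (bigD1 i)//= memNset// mul0r.
    by [].
  rewrite (indepY _ mB) (big_morph _ EFinM erefl).
  by apply: eq_big => [i|i _]; rewrite ?finset.in_setT// eB.
have [nk|kn] := leqP n k.
  apply: IH => // i ki.
  by have := leq_trans (leq_ltn_trans ki (ltn_ord i)) nk; rewrite ltnn.
pose i0 := Ordinal kn.
pose W w := \prod_(i < n | i != i0) h i (Y i w).
have W0 w : 0 <= W w by apply: prodr_ge0.
have mW : measurable_fun setT W by exact: measurable_prodY.
have e0 i : 0 <= e i.
  by rewrite -lee_fin -he integral_ge0// => w _; rewrite lee_fin.
have c0 : 0 <= \prod_(i < n | i != i0) e i by apply: prodr_ge0.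
pose c := NngNum c0.
(* By induction, the law of Y i0 weighted by the other factors is a multiple of
   its law: the two measures agree on every measurable set. *)
pose nu := mscale c (distribution P (Y i0)).
have nuE B : measurable B -> (nu B = \int[P]_(x in Y i0 @^-1` B) (W x)%:E)%E.
  move=> mB.
  pose h' i := if i == i0 then \1_B else h i.
  pose e' i := if i == i0 then fine (P (Y i0 @^-1` B)) else e i.
  have mYB : measurable (Y i0 @^-1` B).
    exact: measurable_funPTI.
  have YB w : \1_B (Y i0 w) = \1_(Y i0 @^-1` B) w :> R by exact: indic_preimage.
  have E' w : \prod_(i < n) h' i (Y i w) = \1_(Y i0 @^-1` B) w * W w.
    rewrite (bigD1 i0)//= {1}/h' eqxx YB; congr (_ * _).
    by apply: eq_bigr => i /negbTE ni; rewrite /h' ni.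
  have : (\int[P]_w (\prod_(i < n) h' i (Y i w))%:E = (\prod_(i < n) e' i)%:E)%E.
    apply: IH => [i|i x|i|i ki]; rewrite /h' /e'.
    - by case: ifP.
    - by case: ifP.
    - case: ifP => [/eqP ->|_]; last exact: he.
      under eq_integral do rewrite YB.
      by rewrite integral_indic// setIT fineK// fin_num_measure.
    - case: ifPn => [_|ni]; first by exists B.
      apply: hB; rewrite ltn_neqAle ki andbT eq_sym.
      by apply: contra ni => /eqP ik; apply/eqP/val_inj.
  under eq_integral do rewrite E'.
  rewrite (bigD1 i0)//= {1}/e' eqxx EFinM fineK ?fin_num_measure//.
  rewrite (eq_bigr e) => [|i /negbTE ni]; last by rewrite /e' ni.
  rewrite /nu /mscale /= muleC => <-.
  rewrite [RHS]integral_mkcond/=; apply: eq_integral => w _.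
  by rewrite epatch_indic EFinM muleC.
transitivity (\int[nu]_y (h i0 y)%:E)%E.
  rewrite (integral_density _ mW W0 nuE)//; last 2 first.
  - exact/measurable_EFinP.
  - by move=> y; rewrite lee_fin.
  by apply: eq_integral => w _; rewrite (bigD1 i0)//= EFinM muleC.
rewrite ge0_integral_mscale//; last 2 first.
- exact/measurable_EFinP.
- by move=> y _; rewrite lee_fin.
rewrite ge0_integral_distribution//; last 2 first.
- exact/measurable_EFinP.
- by move=> y; rewrite lee_fin.
by rewrite /= he -EFinM [in RHS](bigD1 i0)//= mulrC.
Qed.

Lemma expectation_prod (h : 'I_n -> R -> R) (e : 'I_n -> R) :
  (forall i, measurable_fun setT (h i)) -> (forall i x, 0 <= h i x) ->
  (forall i, \int[P]_w (h i (Y i w))%:E = (e i)%:E)%E ->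
  (\int[P]_w (\prod_(i < n) h i (Y i w))%:E = (\prod_(i < n) e i)%:E)%E.
Proof.
move=> mh h0 he; apply: (expectation_prod_indic (k := n)) => // i ni.
by have := leq_ltn_trans ni (ltn_ord i); rewrite ltnn.
Qed.

End Independence.

(** * Tail bounds for sums of independent variables *)

Section Tail.
Context {R : realType} {disp : measure_display} {Om : measurableType disp}.
Variables (P : probability Om R) (n : nat) (Y : 'I_n -> {RV P >-> R}).
Hypothesis indepY : mutually_independent Y.
Variables (mu : 'I_n -> R) (B : 'I_n -> set R) (s : R).
Hypotheses (mB : forall i, measurable (B i)) (s0 : 0 < s).
Hypothesis mgfY : forall i a,
  (\int[P]_w (\1_(B i) (Y i w) * expR (a * (Y i w - mu i)))%:E <=
   (expR (a ^+ 2 * s ^+ 2 / 2))%:E)%E.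

Definition untruncated : set Om := [set w | forall i, B i (Y i w)].

Lemma measurable_untruncated : measurable untruncated.
Proof.
have -> : untruncated = \bigcap_(i in [set: 'I_n]) (Y i @^-1` B i).
  by apply/seteqP; split=> w h i; [move=> _; exact: h|exact: (h i I)].
by apply: fin_bigcap_measurable => // i _; exact: measurable_funPTI.
Qed.

Definition centered_sum (x : 'I_n -> R) (w : Om) : R :=
  \sum_(i < n) x i * (Y i w - mu i).

Lemma measurable_centered_sum x : measurable_fun setT (centered_sum x).
Proof.
apply: measurable_sum => i; apply: measurable_funM => //.
exact: measurable_funB.
Qed.

Lemma measurable_gt_set (f : Om -> R) (r : R) : measurable_fun setT f ->
  measurable [set w | r < f w].
Proof.
move=> mf; have -> : [set w | r < f w] = setT `&` f @^-1` `]r, +oo[.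
  by rewrite setTI; apply/seteqP; split => w /=; rewrite in_itv/= andbT.
exact: mf.
Qed.

(** On the event [untruncated] the exponential of the sum is the product of the
    restricted exponentials, so the restriction is carried by each factor and
    neither the independence nor the centering is disturbed. *)
Lemma chernoff_sum (x : 'I_n -> R) (v r : R) : 0 < v -> 0 < r ->
  \sum_(i < n) x i ^+ 2 <= v ->
  (P (untruncated `&` [set w | (r < centered_sum x w)%R]) <=
   (expR (- (r ^+ 2 / (2 * (s ^+ 2 * v)))))%:E)%E.
Proof.
move=> v0 r0 xv.
have sv0 : 0 < s ^+ 2 * v by rewrite mulr_gt0// exprn_gt0.
(* The minimizer of - t r + t^2 s^2 v / 2. *)
pose t := r / (s ^+ 2 * v).
have t0 : 0 < t by rewrite divr_gt0.
pose h i y := \1_(B i) y * expR (t * x i * (y - mu i)).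
have h0 i y : 0 <= h i y by rewrite mulr_ge0 ?expR_ge0.
have mh i : measurable_fun setT (h i).
  apply: measurable_funM; first exact: measurable_indic.
  apply: measurableT_comp => //; apply: measurable_funM => //.
  exact: measurable_funB.
pose e i := fine (\int[P]_w (h i (Y i w))%:E)%E.
have he i : (\int[P]_w (h i (Y i w))%:E = (e i)%:E)%E.
  rewrite fineK// ge0_fin_numE; last first.
    by apply: integral_ge0 => w _; rewrite lee_fin.
  by apply: le_lt_trans (mgfY i (t * x i)) _; rewrite ltry.
have e_le i : e i <= expR ((t * x i) ^+ 2 * s ^+ 2 / 2).
  by rewrite -lee_fin -he; exact: mgfY.
have e0 i : 0 <= e i.
  by rewrite -lee_fin -he integral_ge0// => w _; rewrite lee_fin.
set E := _ `&` _.
have mE : measurable E.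
  apply: measurableI; first exact: measurable_untruncated.
  by apply: measurable_gt_set; exact: measurable_centered_sum.
apply: (@le_trans _ _ (\int[P]_w ((expR (- (t * r)))%:E *
    (\prod_(i < n) h i (Y i w))%:E))%E).
  rewrite -[E]setIT -integral_indic//.
  apply: ge0_le_integral => //.
  - by apply/measurable_EFinP; exact: measurable_indic.
  - apply: emeasurable_funM => //; apply/measurable_EFinP.
    apply: measurable_prod => i _; exact: (measurableT_comp (mh i)).
  - move=> w _; rewrite -EFinM lee_fin indicE.
    have [wE|_] := boolP (w \in E); last first.
      by rewrite mulr_ge0 ?expR_ge0//; apply: prodr_ge0.
    move: wE; rewrite inE => -[/= wB rw].
    rewrite (eq_bigr (fun i => expR (t * (x i * (Y i w - mu i))))); last first.
      by move=> i _; rewrite /h indicE mem_set// mul1r mulrA.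
    rewrite -expR_sum -expRD -mulr_sumr -/(centered_sum x w).
    rewrite -expR0 ler_expR -mulrN -mulrDr mulr_ge0// ?(ltW t0)//.
    by rewrite addrC subr_ge0 ltW.
rewrite ge0_integralZl//; last 2 first.
- apply/measurable_EFinP.
  apply: measurable_prod => i _; exact: (measurableT_comp (mh i)).
- by move=> w _; rewrite lee_fin; apply: prodr_ge0.
rewrite (expectation_prod indepY mh h0 he) -EFinM lee_fin.
apply: (@le_trans _ _ (expR (- (t * r)) *
    \prod_(i < n) expR ((t * x i) ^+ 2 * s ^+ 2 / 2))).
  rewrite ler_wpM2l ?expR_ge0//; apply: ler_prod => i _.
  by rewrite e0 e_le.
rewrite -expR_sum -expRD ler_expR.
have -> : \sum_(i < n) (t * x i) ^+ 2 * s ^+ 2 / 2 =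
    (t ^+ 2 * s ^+ 2 / 2) * \sum_(i < n) x i ^+ 2.
  by rewrite mulr_sumr; apply: eq_bigr => i _; ring.
have le1 : (t ^+ 2 * s ^+ 2 / 2) * \sum_(i < n) x i ^+ 2 <= t ^+ 2 * s ^+ 2 / 2 * v.
  by rewrite ler_wpM2l// divr_ge0// mulr_ge0 ?sqr_ge0.
apply: (@le_trans _ _ (- (t * r) + t ^+ 2 * s ^+ 2 / 2 * v)).
  by rewrite lerD2l.
rewrite le_eqVlt; apply/orP; left; apply/eqP; rewrite /t.
by field; rewrite !gt_eqF.
Qed.

Lemma chernoff_sum_abs (x : 'I_n -> R) (v r : R) : 0 < v -> 0 < r ->
  \sum_(i < n) x i ^+ 2 <= v ->
  (P (untruncated `&` [set w | (r < `|centered_sum x w|)%R]) <=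
   (2 * expR (- (r ^+ 2 / (2 * (s ^+ 2 * v)))))%:E)%E.
Proof.
move=> v0 r0 xv.
have mU := measurable_untruncated.
have m1 := measurable_gt_set r (measurable_centered_sum x).
have m2 := measurable_gt_set r (measurable_centered_sum (fun i => - x i)).
have oppE w : centered_sum (fun i => - x i) w = - centered_sum x w.
  by rewrite /centered_sum -sumrN; apply: eq_bigr => i _; rewrite mulNr.
have xv' : \sum_(i < n) (- x i) ^+ 2 <= v by under eq_bigr do rewrite sqrrN.
have sub : untruncated `&` [set w | (r < `|centered_sum x w|)%R] =
   (untruncated `&` [set w | r < centered_sum x w]) `|`
   (untruncated `&` [set w | r < centered_sum (fun i => - x i) w]).
  rewrite -setIUr; congr (_ `&` _); apply/seteqP; split => w /=; rewrite oppE lter_normr.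
    by move=> /orP[]; [left|right].
  by move=> /orP.
rewrite sub; apply: le_trans.
  by apply: measureU2; exact: measurableI.
rewrite mulr_natl mulr2n EFinD.
by apply: leeD; exact: chernoff_sum.
Qed.

End Tail.

(** * The noise vector *)

Section NoiseBound.
Context {R : realType} {disp : measure_display} {Om : measurableType disp}.
Variables (P : probability Om R).

Lemma measurable_exists m (A : 'I_m -> set Om) : (forall i, measurable (A i)) ->
  measurable [set w | exists i, A i w].
Proof.
move=> mA; have -> : [set w | exists i, A i w] = \bigcup_(i in setT) A i.
  by apply/seteqP; split => w /= [i]; [exists i|move=> _; exists i].
by apply: fin_bigcup_measurable.
Qed.

Lemma union_bound m (A : 'I_m -> set Om) : (forall i, measurable (A i)) ->
  (P [set w | exists i, A i w] <= \sum_(i < m) P (A i))%E.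
Proof.
elim: m A => [|m IH] A mA.
  rewrite big_ord0; have -> : [set w | exists i, A i w] = set0.
    by apply/seteqP; split => w // [[]].
  by rewrite measure0.
have -> : [set w | exists i, A i w] =
    A ord0 `|` [set w | exists i, A (lift ord0 i) w].
  apply/seteqP; split => w /=.
    by move=> [i]; case: (unliftP ord0 i) => [j ->|->]; [right; exists j|left].
  by move=> [?|[j ?]]; [exists ord0|exists (lift ord0 j)].
rewrite big_ord_recl; apply: le_trans.
  by apply: measureU2 => //; exact: measurable_exists.
by apply: leeD => //; exact: IH.
Qed.

Variables (n d : nat) (Y : 'I_n -> {RV P >-> R}).
Hypothesis indepY : mutually_independent Y.
Hypotheses (n_gt0 : (0 < n)%N) (d_gt0 : (0 < d)%N).
Variables (X : 'M[R]_(n, d)) (mu : 'cV[R]_n) (B : 'I_n -> set R) (s delta q : R).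
Hypothesis hX : forall j : 'I_d, l2norm (col j X) <= Num.sqrt n%:R.
Hypotheses (mB : forall i, measurable (B i)) (s0 : 0 < s) (delta0 : 0 < delta).
Hypothesis mgfY : forall i a,
  (\int[P]_w (\1_(B i) (Y i w) * expR (a * (Y i w - mu i 0)))%:E <=
   (expR (a ^+ 2 * s ^+ 2 / 2))%:E)%E.
Hypothesis truncY : (\sum_(i < n) P (~` (Y i @^-1` B i)) <= q%:E)%E.

Local Notation Lam := (ln (2 * d%:R) + delta).

Let Lam_gt0 : 0 < Lam.
Proof.
rewrite ltr_wpDl// ln_ge0//; have := d_gt0.
by rewrite -(@ler_nat R) => h; lra.
Qed.

Definition noise_radius : R := s * Num.sqrt (2 * Lam / n%:R).

Definition noise_small : set Om := [set w |
  forall j, `|noise_gradient X (response Y w) mu j 0| <= noise_radius].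

Let noiseE w j : noise_gradient X (response Y w) mu j 0 =
  n%:R^-1 * centered_sum Y (fun i => mu i 0) (fun i => X i j) w.
Proof. by rewrite mxE; congr (_ * _); apply: eq_bigr => i _; rewrite mxE mulrC. Qed.

Lemma measurable_noise_small : measurable noise_small.
Proof.
have -> : noise_small = ~` [set w | exists j,
    noise_radius < `|noise_gradient X (response Y w) mu j 0|].
  apply/seteqP; split => w /=.
    by move=> h [j]; rewrite ltNge h.
  by move=> h j; rewrite leNgt; apply/negP => hj; apply: h; exists j.
apply: measurableC; apply: measurable_exists => j.
apply: measurable_gt_set; apply: measurableT_comp => //.
under eq_fun do rewrite noiseE.
by apply: measurable_funM => //; exact: measurable_centered_sum.
Qed.

(** The radius is chosen so that each column fails with probability at most
    [exp (- delta) / d], the factor [2] in the logarithm paying for both signs. *)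
Lemma noise_small_prob : ((1 - expR (- delta) - q)%:E <= P noise_small)%E.
Proof.
have nR : 0 < n%:R :> R by rewrite ltr0n.
have dR : 0 < d%:R :> R by rewrite ltr0n.
pose U := untruncated Y B.
have mU : measurable U by exact: measurable_untruncated.
pose S j := centered_sum Y (fun i => mu i 0) (fun i => X i j).
have mS j : measurable_fun setT (S j) by exact: measurable_centered_sum.
pose r := n%:R * noise_radius.
have r0 : 0 < r.
  by rewrite mulr_gt0// mulr_gt0// sqrtr_gt0 divr_gt0// mulr_gt0.
pose E j := U `&` [set w | r < `|S j w|].
have mE j : measurable (E j).
  by apply: measurableI => //; apply: measurable_gt_set; exact: measurableT_comp.
have colX j : \sum_(i < n) X i j ^+ 2 <= n%:R.
  have := hX j; rewrite /l2norm ler_sqrt ?ler0n//.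
  by under eq_bigr do rewrite mxE.
have PE j : (P (E j) <= (expR (- delta) / d%:R)%:E)%E.
  apply: le_trans (chernoff_sum_abs indepY mB s0 mgfY nR r0 (colX j)) _.
  rewrite lee_fin.
  have -> : r ^+ 2 / (2 * (s ^+ 2 * n%:R)) = Lam.
    rewrite /r /noise_radius !exprMn sqr_sqrtr; last first.
      by rewrite divr_ge0// ?ler0n// mulr_ge0// ltW.
    by field; rewrite !gt_eqF.
  rewrite opprD expRD [expR (- ln _)]expRN lnK ?posrE ?mulr_gt0//.
  by rewrite le_eqVlt; apply/orP; left; apply/eqP; field; rewrite gt_eqF.
have PU : (P (~` U) <= q%:E)%E.
  apply: le_trans truncY.
  have -> : ~` U = [set w | exists i, (~` (Y i @^-1` B i)) w].
    by apply/seteqP; split => w /=; rewrite existsNE.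
  apply: union_bound => i; apply: measurableC; exact: measurable_funPTI.
have sub : ~` noise_small `<=` ~` U `|` [set w | exists j, E j w].
  move=> w /= /existsNP [j]; have [wU|nU] := pselect (U w); last by left.
  move=> /negP; rewrite -ltNge noiseE normrM ger0_norm ?invr_ge0// => h.
  right; exists j; split => //=; rewrite /r.
  by rewrite -ltr_pdivlMl.
have mns := measurable_noise_small.
have : (P (~` noise_small) <= (q + expR (- delta))%:E)%E.
  apply: le_trans.
    apply: le_measure sub; rewrite inE; first exact: measurableC.
    apply: measurableU; [exact: measurableC|exact: measurable_exists].
  apply: le_trans.
    by apply: measureU2; [exact: measurableC|exact: measurable_exists].
  rewrite EFinD; apply: leeD => //; apply: le_trans (union_bound mE) _.
  apply: (@le_trans _ _ (\sum_(j < d) (expR (- delta) / d%:R)%:E)%E).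
    by apply: lee_sum.
  rewrite sumEFin sumr_const card_ord -[_ *+ d]mulr_natr divfK ?gt_eqF//.
rewrite probability_setC//.
have := fin_num_measure P _ mns.
move=> /fineK <-; rewrite -EFinB !lee_fin; lra.
Qed.

End NoiseBound.

(** * Moment generating functions of the responses *)

Section Laws.
Context {R : realType} {disp : measure_display} {Om : measurableType disp}.
Variables (P : probability Om R) (Y : {RV P >-> R}).
Local Open Scope ereal_scope.

Lemma integral_law d' (T' : measurableType d') (m : {measure set T' -> \bar R})
    (Z : T' -> R) (W : T' -> R) (h : R -> \bar R) :
  measurable_fun setT Z -> measurable_fun setT W -> (forall x, (0 <= W x)%R) ->
  (forall B, measurable B ->
     distribution P Y B = \int[m]_(x in Z @^-1` B) (W x)%:E) ->
  measurable_fun setT h -> (forall y, 0 <= h y) ->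
  \int[P]_w h (Y w) = \int[m]_x ((W x)%:E * h (Z x)).
Proof.
move=> mZ mW W0 lawY mh h0.
by rewrite -(integral_density mZ mW W0 lawY mh h0) ge0_integral_distribution.
Qed.

Lemma integral_dirac_law (a : R) (h : R -> \bar R) :
  (forall B, measurable B -> distribution P Y B = \d_a B) ->
  measurable_fun setT h -> (forall y, 0 <= h y) ->
  \int[P]_w h (Y w) = h a.
Proof.
move=> lawY mh h0; rewrite -ge0_integral_distribution//.
rewrite (eq_measure_integral (\d_a))//; last by move=> B mB _; exact: lawY.
by rewrite integral_dirac// diracT mul1e.
Qed.

Let measurable_expM (a c : R) :
  measurable_fun setT (fun y : R => (expR (a * (y - c)))%:E).
Proof.
apply/measurable_EFinP; apply: measurableT_comp => //.
by apply: measurable_funM => //; exact: measurable_funB.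
Qed.

(** The exponential shifts the mean of the Gaussian density by [a * s ^+ 2]. *)
Lemma normal_mgf (mu s a : R) : s != 0%R ->
  (forall B, measurable B -> distribution P Y B = normal_prob mu s B) ->
  \int[P]_w (expR (a * (Y w - mu)))%:E = (expR (a ^+ 2 * s ^+ 2 / 2))%:E.
Proof.
move=> s0 lawY.
rewrite (@integral_law _ _ (@lebesgue_measure R) id (normal_pdf mu s)
  (fun y : R => (expR (a * (y - mu)))%:E))//; last 2 first.
- exact: measurable_normal_pdf.
- by move=> x; exact: normal_pdf_ge0.
under eq_integral.
  move=> x _.
  have -> : (normal_pdf mu s x)%:E * (expR (a * (x - mu)))%:E =
     (expR (a ^+ 2 * s ^+ 2 / 2))%:E * (normal_pdf (mu + a * s ^+ 2) s x)%:E.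
    rewrite -!EFinM !normal_pdfE// /normal_fun; congr (_%:E).
    rewrite -[LHS]mulrA [RHS]mulrCA -!expRD; congr (_ * expR _)%R.
    by field.
  over.
rewrite ge0_integralZl//; last 2 first.
- by apply/measurable_EFinP; exact: measurable_normal_pdf.
- by move=> x _; rewrite lee_fin normal_pdf_ge0.
by rewrite integral_normal_pdf mule1.
Qed.

Lemma bernoulli_mgf (p a : R) : (0 <= p <= 1)%R ->
  (forall B, measurable B -> distribution P Y B =
    pushforward (bernoulli_prob p) (fun k : bool => k%:R : R) B) ->
  \int[P]_w (expR (a * (Y w - p)))%:E <= (expR (a ^+ 2 * 2^-1 ^+ 2 / 2))%:E.
Proof.
move=> p01 lawY.
rewrite (@integral_law _ _ (bernoulli_prob p) (fun k : bool => k%:R : R) (cst 1%R)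
  (fun y : R => (expR (a * (y - p)))%:E))//; last first.
  by move=> B mB; rewrite lawY//= (integral_cst (bernoulli_prob p) _ 1)// mul1e.
under eq_integral do rewrite mul1e.
rewrite integral_bernoulli_prob//=.
rewrite -!EFinM -EFinD lee_fin.
have -> : (p * expR (a * (1 - p)) + (1 - p) * expR (a * (0 - p)) =
   expR (- (p * a)) * (p * expR a + (1 - p)))%R.
  have -> : (expR (a * (1 - p)) = expR (- (p * a)) * expR a)%R.
    by rewrite -expRD; congr expR; ring.
  have -> : (a * (0 - p) = - (p * a))%R by ring.
  by ring.
have -> : (a ^+ 2 * 2^-1 ^+ 2 / 2 = - (p * a) + (p * a + a ^+ 2 / 8))%R by field.
by rewrite expRD ler_wpM2l ?expR_ge0// hoeffding_mgf.
Qed.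

(** The exponential turns the mass function of rate [l] into a multiple of that of
    rate [l * expR a], which has total mass one. *)
Lemma poisson_mgf (l a : R) : (0 <= l)%R ->
  (forall B, measurable B -> distribution P Y B =
    pushforward (poisson_prob l 0%N) (fun k : nat => k%:R : R) B) ->
  \int[P]_w (expR (a * Y w))%:E = (expR (l * (expR a - 1)))%:E.
Proof.
move=> l0 lawY.
have mh : measurable_fun setT (fun y : R => (expR (a * y))%:E).
  by apply/measurable_EFinP; apply: measurableT_comp => //; exact: measurable_funM.
have [lE|ln0] := eqVneq l 0%R.
  rewrite (@integral_dirac_law 0 (fun y => (expR (a * y))%:E))//.
  - by rewrite mulr0 lE mul0r.
  - move=> B mB; rewrite lawY// /pushforward /poisson_prob lE ltxx.
    by rewrite !diracE; congr (_%:R%:E); apply/idP/idP; rewrite !inE.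
have {ln0}l0 : (0 < l)%R by rewrite lt_neqAle eq_sym ln0.
have countE (r : R) U : (0 < r)%R -> poisson_prob r 0 U =
    \int[counting]_(k in U) (poisson_pmf r k)%:E.
  move=> r0; rewrite /poisson_prob r0 integral_mkcond ge0_integral_count => [|k]; last first.
    by rewrite /patch; case: ifP => // _; rewrite lee_fin poisson_pmf_ge0.
  rewrite nneseries_esumT => [|k]; last first.
    by rewrite /patch; case: ifP => // _; rewrite lee_fin poisson_pmf_ge0.
  by rewrite esum_mkcond; apply: eq_esum => k _; rewrite /patch.
rewrite (@integral_law _ _ (@counting nat R) (fun k : nat => k%:R : R) (poisson_pmf l)
  (fun y : R => (expR (a * y))%:E))//; last 2 first.
- by move=> k; exact: poisson_pmf_ge0.
- by move=> B mB; rewrite lawY// /pushforward countE.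
have la0 : (0 < l * expR a)%R by rewrite mulr_gt0 ?expR_gt0.
under eq_integral.
  move=> k _.
  have -> : (poisson_pmf l k)%:E * (expR (a * k%:R))%:E =
    (expR (l * (expR a - 1)))%:E * (poisson_pmf (l * expR a) k)%:E.
    rewrite -!EFinM /poisson_pmf l0 la0 exprMn -expRM_natr; congr (_%:E).
    have -> : expR (- l) = (expR (l * (expR a - 1)) * expR (- (l * expR a)))%R.
      by rewrite -expRD; congr expR; ring.
    by ring.
  over.
rewrite ge0_integralZl//; last first.
  by move=> x _; rewrite lee_fin poisson_pmf_ge0.
by rewrite -countE// probability_setT mule1.
Qed.

End Laws.

(** * Truncated Poisson variables *)

Section PoissonTruncation.
Context {R : realType}.

Lemma expR1_le3 : expR 1 <= 3 :> R.
Proof.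
(* The bound 1 + x <= exp x at x = - 1/6, raised to the power six: (6/5)^6 < 3. *)
have h : 5 / 6 <= expR (- (6^-1)) :> R.
  by apply: le_trans (expR_ge1Dx _); lra.
have -> : expR 1 = (expR (- 6^-1) ^+ 6)^-1 :> R.
  by rewrite -expRM_natl -expRN; congr expR; field.
have h6 : (5 / 6) ^+ 6 <= expR (- (6^-1)) ^+ 6 :> R.
  by rewrite lerXn2r ?nnegrE ?expR_ge0// divr_ge0.
rewrite invf_ple ?posrE ?exprn_gt0 ?expR_gt0//.
apply: le_trans h6; lra.
Qed.

Lemma ln_ge1 (n : nat) : (3 <= n)%N -> 1 <= ln (n%:R : R).
Proof.
move=> n3; have n0 : 0 < n%:R :> R by rewrite ltr0n (leq_trans _ n3).
rewrite -ler_expR lnK ?posrE//; apply: le_trans expR1_le3 _.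
by rewrite ler_nat.
Qed.

Lemma expR_quadratic (a : R) : a <= 1 -> expR a - 1 - a <= 3 / 2 * a ^+ 2.
Proof.
move=> a1.
have itD : is_interval [set v : R | v <= 1].
  by move=> v w /= _ w1 z /andP[_ zw]; exact: le_trans zw w1.
have := curvature_above itD (@curvature_expR R 1) a1 (ler01 : [set v : R | v <= 1] 0).
rewrite expR0 mul1r subr0 => h.
have h2 : expR 1 / 2 * a ^+ 2 <= 3 / 2 * a ^+ 2.
  by rewrite ler_wpM2r ?sqr_ge0// ler_wpM2r// expR1_le3.
lra.
Qed.

Context {disp : measure_display} {Om : measurableType disp}.
Variables (P : probability Om R) (Y : {RV P >-> R}) (l : R).
Hypothesis l0 : 0 <= l.
Hypothesis lawY : forall B, measurable B -> distribution P Y B =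
  pushforward (poisson_prob l 0%N) (fun k : nat => k%:R : R) B.

Let measurable_le (K : R) : measurable [set y : R | y - l <= K].
Proof.
have -> : [set y : R | y - l <= K] = [set` `]-oo, K + l]].
  by apply/seteqP; split => y /=; rewrite in_itv/= lerBlDr.
exact: measurable_itv.
Qed.

Let measurable_expY (a : R) : measurable_fun setT (fun w => expR (a * (Y w - l))).
Proof.
apply: measurableT_comp => //; apply: measurable_funM => //.
exact: measurable_funB.
Qed.

Lemma poisson_centered_mgf (a : R) :
  (\int[P]_w (expR (a * (Y w - l)))%:E = (expR (l * (expR a - 1 - a)))%:E)%E.
Proof.
under eq_integral.
  move=> w _.
  have -> : expR (a * (Y w - l)) = expR (- (a * l)) * expR (a * Y w).
    by rewrite -expRD; congr expR; ring.
  rewrite EFinM; over.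
rewrite ge0_integralZl//.
- rewrite (poisson_mgf a l0 lawY) -EFinM -expRD; congr (expR _)%:E; ring.
- apply/measurable_EFinP/measurableT_comp => //; exact: measurable_funM.
Qed.

(** For [a <= 1] the full generating function is already quadratic in [a]; for
    [a > 1], where it grows too fast, the truncation bounds the exponential. *)
Lemma poisson_truncated_mgf (K s a : R) :
  3 * l <= s ^+ 2 -> K <= s ^+ 2 / 2 ->
  (\int[P]_w (\1_[set y | (y - l <= K)%R] (Y w) * expR (a * (Y w - l)))%:E <=
   (expR (a ^+ 2 * s ^+ 2 / 2))%:E)%E.
Proof.
move=> ls Ks.
have mI := measurable_le K.
have mF : measurable_fun setT
    (fun w => (\1_[set y | y - l <= K] (Y w) * expR (a * (Y w - l)))%:E).
  apply/measurable_EFinP; apply: measurable_funM => //.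
  by apply: measurableT_comp => //; exact: measurable_indic.
have F0 w : (0 <= (\1_[set y | (y - l <= K)%R] (Y w) * expR (a * (Y w - l)))%:E)%E.
  by rewrite lee_fin mulr_ge0 ?expR_ge0.
have [a1|a1] := leP a 1.
  apply: (@le_trans _ _ (\int[P]_w (expR (a * (Y w - l)))%:E)%E).
    apply: ge0_le_integral => //.
    - by apply/measurable_EFinP.
    - move=> w _; rewrite lee_fin ler_piMl ?expR_ge0//.
  rewrite poisson_centered_mgf lee_fin ler_expR.
  apply: (@le_trans _ _ (l * (3 / 2 * a ^+ 2))).
    by rewrite ler_wpM2l// expR_quadratic.
  have := sqr_ge0 a => a2.
  have -> : l * (3 / 2 * a ^+ 2) = a ^+ 2 * (3 * l) / 2 by field.
  by rewrite ler_pM2r// ler_wpM2l.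
apply: (@le_trans _ _ (\int[P]_w (cst (expR (a * K))%:E w))%E).
  apply: ge0_le_integral => //.
  - move=> w _; rewrite lee_fin indicE.
    have [|_] := boolP (Y w \in _); last by rewrite mul0r expR_ge0.
    rewrite inE /= mul1r => h; rewrite ler_expR ler_wpM2l//.
    by rewrite (le_trans _ (ltW a1)).
rewrite integral_cst//= probability_setT mule1 lee_fin ler_expR.
have a0 : 0 <= a by rewrite (le_trans _ (ltW a1)).
have e1 : a * K <= a * (s ^+ 2 / 2) by rewrite ler_wpM2l.
have e2 : a * (s ^+ 2 / 2) <= a * (a * (s ^+ 2 / 2)).
  rewrite ler_wpM2l// ler_peMl ?(ltW a1)//.
  by rewrite divr_ge0// sqr_ge0.
by rewrite -mulrA expr2 -mulrA (le_trans e1).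
Qed.

(** Chernoff's bound at the exponent [1]; the term [l] in the bound comes from
    [expR 1 - 2 <= 1]. *)
Lemma poisson_tail (K : R) :
  (P (~` (Y @^-1` [set y | (y - l <= K)%R])) <= (expR (l - K))%:E)%E.
Proof.
set E := ~` _.
have mE : measurable E.
  by apply: measurableC; apply: measurable_funPTI; exact: measurable_le.
rewrite -[E]setIT -integral_indic//.
apply: (@le_trans _ _ (\int[P]_w ((expR (- K))%:E * (expR (1 * (Y w - l)))%:E))%E).
  apply: ge0_le_integral => //.
  - by apply/measurable_EFinP; exact: measurable_indic.
  - by apply: emeasurable_funM => //; exact/measurable_EFinP.
  - move=> w _; rewrite -EFinM lee_fin indicE.
    have [|_] := boolP (w \in E); last by rewrite mulr_ge0 ?expR_ge0.
    rewrite inE /E /= => /negP; rewrite -ltNge => h.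
    by rewrite mul1r -expRD -[leLHS]expR0 ler_expR addrC subr_ge0 ltW.
rewrite ge0_integralZl//; last exact/measurable_EFinP.
rewrite poisson_centered_mgf -EFinM lee_fin -expRD ler_expR.
have := expR1_le3 => e3.
have : l * (expR 1 - 1 - 1) <= l * 1 by rewrite ler_wpM2l//; lra.
lra.
Qed.

End PoissonTruncation.

(** * Subgaussian noise in the three models *)

Section CaseNoise.
Context {R : realType} {disp : measure_display} {Om : measurableType disp}.
Variables (P : probability Om R) (n : nat).
Hypothesis n_gt0 : (0 < n)%N.
Variables (c : glm_case R n) (mu : 'cV[R]_n).
Hypothesis params : valid_params c mu.
Variable Y : 'I_n -> {RV P >-> R}.
Hypothesis law : forall (i : 'I_n) (B : set R), measurable B ->
  distribution P (Y i) B = response_law c mu i B.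

Let untruncatedP (s : R) :
  (forall i a, \int[P]_w (expR (a * (Y i w - mu i 0)))%:E <=
    (expR (a ^+ 2 * s ^+ 2 / 2))%:E)%E ->
  (forall i a, \int[P]_w (\1_setT (Y i w) * expR (a * (Y i w - mu i 0)))%:E <=
    (expR (a ^+ 2 * s ^+ 2 / 2))%:E)%E /\
  (\sum_(i < n) P (~` (Y i @^-1` setT)) <= 0%:E)%E.
Proof.
move=> h; split=> [i a|].
  by under eq_integral do rewrite indicT mul1r; exact: h.
by rewrite big1// => i _; rewrite preimage_setT setCT measure0.
Qed.

(** In all models the responses are subgaussian at the noise level on sets [B i]
    that they leave with total probability at most [q].  For Gaussian and Bernoulli
    responses these sets are everything and [q] is zero. *)
Lemma noise_subgaussian (delta : R) : proviso c delta ->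
  exists (B : 'I_n -> set R) (q : R),
  [/\ (forall i, measurable (B i)),
      (forall i a, \int[P]_w (\1_(B i) (Y i w) * expR (a * (Y i w - mu i 0)))%:E <=
        (expR (a ^+ 2 * noise_level c mu ^+ 2 / 2))%:E)%E,
      (\sum_(i < n) P (~` (Y i @^-1` B i)) <= q%:E)%E &
      success_prob c delta = 1 - expR (- delta) - q].
Proof.
case: c params law => [s||] /= par lawY prov.
- exists (fun=> setT), 0.
  have h i a : (\int[P]_w (expR (a * (Y i w - mu i 0)))%:E <=
    (expR (a ^+ 2 * (\big[Num.max/0]_(i < n) s i) ^+ 2 / 2))%:E)%E.
    have le_s : a ^+ 2 * s i ^+ 2 / 2 <= a ^+ 2 * (\big[Num.max/0]_(i < n) s i) ^+ 2 / 2.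
      rewrite ler_pM2r// ler_wpM2l ?sqr_ge0// lerXn2r ?nnegrE ?par//.
        exact: le_trans (par i) (le_bigmax _ _ i).
      exact: le_bigmax.
    have [si|si] := eqVneq (s i) 0.
      rewrite (@integral_dirac_law _ _ _ _ (Y i) (mu i 0)
        (fun y => (expR (a * (y - mu i 0)))%:E))//.
      + rewrite subrr mulr0 lee_fin ler_expR; apply: le_trans le_s.
        by rewrite divr_ge0// mulr_ge0 ?sqr_ge0.
      + by move=> B mB; rewrite lawY// si eqxx.
      + apply/measurable_EFinP; apply: measurableT_comp => //.
        by apply: measurable_funM => //; exact: measurable_funB.
    rewrite (normal_mgf a si) ?lee_fin ?ler_expR// => B mB.
    by rewrite lawY// (negbTE si).
  by have [h1 h2] := untruncatedP h; split => //; rewrite subr0.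
- exists (fun=> setT), 0.
  have h i a : (\int[P]_w (expR (a * (Y i w - mu i 0)))%:E <=
    (expR (a ^+ 2 * 2^-1 ^+ 2 / 2))%:E)%E.
    by apply: bernoulli_mgf => // B mB; exact: lawY.
  by have [h1 h2] := untruncatedP h; split => //; rewrite subr0.
- have [d1 n3] := prov.
  have L1 := @ln_ge1 R n n3.
  set ell := ln n%:R in L1 *; set m := `|mu|.
  have m0 : 0 <= m by exact: normr_ge0.
  have mum i : mu i 0 <= m by exact: le_trans (ler_norm _) (le_mx_norm mu i 0).
  (* Twice ell makes the tail of each response at most 1 / n^2, and m absorbs
     the factor l that Chernoff's bound leaves in the exponent. *)
  pose K := 2 * ell + m.
  exists (fun i => [set y | y - mu i 0 <= K]), n%:R^-1.
  set sg := _ + 3 * _.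
  have sq0 : 0 <= Num.sqrt m by exact: sqrtr_ge0.
  have sg1 : (6 * m + 2) * ell <= sg by rewrite lerDl mulr_ge0.
  have sg2 : 3 * Num.sqrt m <= sg by rewrite lerDr mulr_ge0//; lra.
  have sgA : 3 * m <= sg ^+ 2.
    apply: (@le_trans _ _ ((3 * Num.sqrt m) ^+ 2)).
      by rewrite exprMn sqr_sqrtr//; lra.
    by rewrite lerXn2r ?nnegrE ?mulr_ge0// (le_trans _ sg2)// mulr_ge0.
  (* As ell >= 1, sg^2 is at least (24 m + 4) ell, hence at least 2 K. *)
  have sgB : K <= sg ^+ 2 / 2.
    have ell0 : 0 <= ell by lra.
    have p0 : 0 <= (6 * m + 2) * ell by rewrite mulr_ge0//; lra.
    have h1 : ((6 * m + 2) * ell) ^+ 2 <= sg ^+ 2.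
      by rewrite lerXn2r ?nnegrE// (le_trans p0).
    have h2 : ell <= ell ^+ 2 by rewrite expr2 ler_peMl.
    have h3 : (24 * m + 4) * ell <= ((6 * m + 2) * ell) ^+ 2.
      apply: (@le_trans _ _ ((24 * m + 4) * ell ^+ 2)).
        by rewrite ler_wpM2l//; lra.
      rewrite exprMn ler_wpM2r ?sqr_ge0//.
      have := sqr_ge0 m; rewrite !expr2 => m2; lra.
    have h4 : m <= m * ell by rewrite ler_peMr.
    have h5 : 0 <= m * ell by rewrite mulr_ge0.
    rewrite /K; lra.
  split => // [i|i a|].
  + have -> : [set y : R | y - mu i 0 <= K] = [set` `]-oo, K + mu i 0]].
      by apply/seteqP; split => y /=; rewrite in_itv/= lerBlDr.
    exact: measurable_itv.
  + apply: poisson_truncated_mgf => //; first by move=> B mB; exact: lawY.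
    by apply: le_trans sgA; rewrite ler_pM2l.
  + have nR : 0 < n%:R :> R by rewrite ltr0n.
    apply: (@le_trans _ _ (\sum_(i < n) (n%:R^-1 ^+ 2)%:E)%E).
      apply: lee_sum => i _.
      apply: le_trans (poisson_tail (par i) _ K) _; first by move=> B mB; exact: lawY.
      rewrite lee_fin -[leRHS]lnK ?posrE ?exprn_gt0 ?invr_gt0// ler_expR.
      rewrite lnXn ?invr_gt0// lnV ?posrE// -/ell mulr2n /K.
      have := mum i; lra.
    rewrite sumEFin sumr_const card_ord lee_fin -[_ *+ n]mulr_natr expr2 -mulrA mulVf ?mulr1//.
    by rewrite gt_eqF.
Qed.

End CaseNoise.

(** * Log-partition functions *)

Section LogPartition.
Context {R : realType} {n d : nat}.
Implicit Type c : glm_case R n.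

Definition mean_function c : R -> R :=
  match c with
  | Gaussian _ => id
  | Bernoulli => logistic
  | Poisson => expR
  end.

Definition curvature_bound c (r : R) : R :=
  match c with
  | Gaussian _ => 1
  | Bernoulli => 4^-1
  | Poisson => expR r
  end.

Lemma log_partition_curvature c (r : R) :
  has_curvature (log_partition c) (mean_function c) [set v | `|v| <= r]
    (curvature_bound c r).
Proof.
case: c => [s||] /=.
- exact: curvature_sqr.
- exact: has_curvatureS (fun _ _ => I) curvature_softplus.
- apply: has_curvatureS (curvature_expR r) => v /=.
  exact: le_trans (ler_norm v).
Qed.

Lemma curvature_bound_ge0 c (r : R) : 0 <= curvature_bound c r.
Proof. by case: c => [s||] /=; rewrite ?ler01 ?invr_ge0 ?expR_ge0. Qed.

Lemma smoothness_constE c (X : 'M[R]_(n, d)) : smoothness_const c X =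
  n%:R^-1 * \sum_(i < n) curvature_bound c `|row i X| * `|row i X| ^+ 2.
Proof.
case: c => [s||] //=; first by under [in RHS]eq_bigr do rewrite mul1r.
by rewrite -mulr_sumr mulrA invfM mulrC [4^-1 * _]mulrC mulrC.
Qed.

Lemma measurable_log_partition c : measurable_fun setT (log_partition c).
Proof.
apply: continuous_measurable_fun => v.
apply/differentiable_continuous/derivable1_diffP.
have [dAP _] := log_partition_curvature c 0.
by case: (dAP v).
Qed.

Lemma measurable_mean_function c : measurable_fun setT (mean_function c).
Proof.
apply: continuous_measurable_fun; case: c => [s||] /= v.
- exact: cvg_id.
- apply/differentiable_continuous/derivable1_diffP.
  by case: (is_derive_logistic v).
- exact: continuous_expR.
Qed.

End LogPartition.

(** * Measurability of the iterates, and the risk *)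

Section RandomIterates.
Context {R : realType} {disp : measure_display} {Om : measurableType disp}.
Variables (P : probability Om R) (n d : nat) (Y : 'I_n -> {RV P >-> R}).
Variables (A dA : R -> R) (X : 'M[R]_(n, d)).
Hypothesis dAP : forall v : R, is_derive v 1 A (dA v).
Hypotheses (mA : measurable_fun setT A) (mdA : measurable_fun setT dA).

Let measurable_predictor (th : Om -> 'cV[R]_d) (i : 'I_n) :
  (forall j, measurable_fun setT (fun w => th w j 0)) ->
  measurable_fun setT (fun w => (X *m th w) i 0).
Proof.
move=> mth; under eq_fun do rewrite mulmx_cVE.
by apply: measurable_sum => j; exact: measurable_funM.
Qed.

Lemma measurable_empirical_loss (y : 'cV[R]_n) (th : Om -> 'cV[R]_d) :
  (forall j, measurable_fun setT (fun w => th w j 0)) ->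
  measurable_fun setT (fun w => empirical_loss A X y (th w)).
Proof.
move=> mth; under eq_fun do rewrite empirical_lossE.
apply: measurable_funM => //; apply: measurable_sum => i.
apply: measurable_funB.
  by apply: measurableT_comp => //; exact: measurable_predictor.
by apply: measurable_funM => //; exact: measurable_predictor.
Qed.

Lemma measurable_egd (eta : R) (u : 'cV[R]_d) (t : nat) (j : 'I_d) : simplex u ->
  measurable_fun setT
    (fun w => egd eta (empirical_loss A X (response Y w)) u t j 0).
Proof.
move=> su; elim: t j => [|t IH] j; first exact: measurable_cst.
pose th w := egd eta (empirical_loss A X (response Y w)) u t.
have sth w : simplex (th w) by exact: egd_simplex.
pose s w := - eta *: loss_gradient dA X (response Y w) (th w).
have ms k : measurable_fun setT (fun w => expR (s w k 0)).
  apply: measurableT_comp => //.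
  under eq_fun do rewrite !mxE.
  apply: measurable_funM => //; apply: measurable_funM => //.
  apply: measurable_sum => i; apply: measurable_funM => //.
  apply: measurable_funB.
    by apply: measurableT_comp => //; apply: measurable_predictor => l; exact: IH.
  by under eq_fun do rewrite mxE; exact: measurable_funPT.
(* The normalizing factor is an exponential of a logarithm, hence measurable. *)
have -> : (fun w => egd eta (empirical_loss A X (response Y w)) u t.+1 j 0) =
    (fun w => th w j 0 * expR (s w j 0) * expR (- ln (tilt_mass (th w) (s w)))).
  apply/funext => w; rewrite /egd iterS -/(egd _ _ _ _) egd_step_tilt; last exact: sth.
  rewrite (gradient_loss X dAP) mxE; congr (_ * _).
  by rewrite expRN lnK// posrE; apply: tilt_mass_gt0; exact: sth.
apply: measurable_funM; first exact: measurable_funM.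
apply: measurableT_comp => //; apply: measurableT_comp => //.
apply: measurableT_comp; first exact: measurable_ln.
by apply: measurable_sum => k; exact: measurable_funM.
Qed.

(** The loss is affine in the responses, which are integrable because their
    expectations are finite. *)
Lemma prediction_riskE (mu : 'cV[R]_n) (th : 'cV[R]_d) :
  (forall i, 'E_P[Y i] = (mu i 0)%:E)%E ->
  prediction_risk A X Y th = empirical_loss A X mu th.
Proof.
move=> meanY; rewrite /prediction_risk /empirical_loss; congr (_ * _).
have EY i : (\int[P]_w (Y i w)%:E = (mu i 0)%:E)%E by rewrite -meanY unlock.
have iY i : P.-integrable setT (fun w => (Y i w)%:E).
  apply/integrableP; split; first exact/measurable_EFinP.
  by rewrite integral_fin_num_abs// EY.
rewrite unlock.
pose K := \sum_(i < n) A ((X *m th) i 0).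
have E w : ((neg_loglik A X (response Y w) th)%:E =
    \sum_(i < n) ((- (X *m th) i 0)%:E * (Y i w)%:E) + K%:E)%E.
  rewrite /neg_loglik dot_predictor EFinD; congr (_ + _)%E.
  rewrite -sumrN -sumEFin; apply: eq_bigr => i _.
  by rewrite mxE -EFinM mulNr mulrC.
under eq_integral do rewrite E.
have iS i : P.-integrable setT (fun w => ((- (X *m th) i 0)%:E * (Y i w)%:E)%E).
  exact: integrableZl.
rewrite integralD//=; last 2 first.
- exact: integrable_sum.
- exact: finite_measure_integrable_cst.
rewrite integral_sum// (integral_cst P measurableT)/= probability_setT mule1.
under eq_bigr do rewrite integralZl// EY -EFinM.
rewrite sumEFin -EFinD /= /neg_loglik dot_predictor; congr (_ + _).
by rewrite -sumrN; apply: eq_bigr => i _; rewrite mulNr mulrC.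
Qed.

End RandomIterates.

(** * The risk bound *)

Section Tuning.
Context {R : realType}.
Variables (sigma b Lam n eta : R).
Hypotheses (sigma0 : 0 < sigma) (b0 : 0 < b) (Lam0 : 0 < Lam) (n0 : 0 < n).
Hypothesis eta0 : 0 <= eta.
Let lambda := sigma * Num.sqrt (Lam / (b * n)).

(** The two terms are equal at [K = 1 / lambda].  Rounding [K] up by at most
    [eta] decreases the second one and increases the first by at most [eta] times
    its coefficient. *)
Lemma tuned_bound (K : R) : 1 / lambda <= K <= 1 / lambda + eta ->
  K * (sigma * Num.sqrt (2 * Lam / n)) ^+ 2 / 2 + b / K <=
  2 * sigma * Num.sqrt (b * Lam / n) + eta * sigma ^+ 2 * Lam / n.
Proof.
rewrite /lambda; set q := Num.sqrt (Lam / (b * n)).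
have q0 : 0 < q by rewrite sqrtr_gt0 divr_gt0// mulr_gt0.
have q2 : q ^+ 2 = Lam / (b * n).
  by rewrite sqr_sqrtr// divr_ge0 ?ltW// mulr_gt0.
have LE : Lam / n = b * q ^+ 2 by rewrite q2; field; rewrite !gt_eqF.
have -> : Num.sqrt (b * Lam / n) = b * q.
  rewrite -mulrA LE (_ : b * (b * q ^+ 2) = (b * q) ^+ 2); last by ring.
  by rewrite sqrtr_sqr ger0_norm// mulr_ge0 ?ltW.
have -> : (sigma * Num.sqrt (2 * Lam / n)) ^+ 2 = 2 * (sigma ^+ 2 * (b * q ^+ 2)).
  rewrite exprMn sqr_sqrtr -?LE; first by ring.
  by rewrite !mulr_ge0// ?invr_ge0 ltW.
have -> : eta * sigma ^+ 2 * Lam / n = eta * (sigma ^+ 2 * (b * q ^+ 2)).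
  by rewrite -LE; ring.
move=> /andP[K1 K2].
have l0 : 0 < sigma * q by rewrite mulr_gt0.
have K0 : 0 < K by apply: lt_le_trans K1; rewrite divr_gt0.
have bK : b / K <= b * (sigma * q).
  rewrite ler_pM2l// invf_ple ?posrE//.
  by move: K1; rewrite div1r.
have h : K * (sigma ^+ 2 * (b * q ^+ 2)) <=
    (1 / (sigma * q) + eta) * (sigma ^+ 2 * (b * q ^+ 2)).
  by rewrite ler_wpM2r// !mulr_ge0 ?sqr_ge0 ?ltW.
have e : (1 / (sigma * q) + eta) * (sigma ^+ 2 * (b * q ^+ 2)) =
    b * (sigma * q) + eta * (sigma ^+ 2 * (b * q ^+ 2)).
  by field; rewrite !gt_eqF.
rewrite e in h; lra.
Qed.

End Tuning.

Theorem theorem6 (R : realType) (disp : measure_display)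
    (Om : measurableType disp) (P : probability Om R)
    (n d : nat) (n_gt0 : (0 < n)%N)
    (X : 'M[R]_(n, d))
    (hX : forall j : 'I_d, l2norm (col j X) <= Num.sqrt n%:R)
    (c : glm_case R n) (mu : 'cV[R]_n) (hparams : valid_params c mu)
    (Y : 'I_n -> {RV P >-> R})
    (hindep : mutually_independent Y)
    (hlaw : forall (i : 'I_n) (B : set R), measurable B ->
       distribution P (Y i) B = response_law c mu i B)
    (hmean : forall i : 'I_n, 'E_P[Y i]%E = (mu i 0)%:E) :
  let A := log_partition c in
  let sigma := noise_level c mu in
  let L := smoothness_const c X in
  let f := fun w : Om => empirical_loss A X (response Y w) in
  let Risk := prediction_risk A X Y in
  (forall w : Om, l1_smooth L (@simplex R d) (f w)) /\
  (forall (eta : R) (u : 'cV[R]_d) (delta b : R),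
     0 < eta -> eta * L <= 1 -> simplex u -> 0 < delta -> 0 < b ->
     0 < sigma -> proviso c delta ->
     let theta := fun (w : Om) (t : nat) => egd eta (f w) u t in
     let lambda := sigma * Num.sqrt ((ln (2 * d%:R) + delta) / (b * n%:R)) in
     let Tstar := 1 / (eta * lambda) in
     let bound := 2 * sigma * Num.sqrt (b * (ln (2 * d%:R) + delta) / n%:R) in
     let e_T := eta * sigma ^+ 2 * (ln (2 * d%:R) + delta) / n%:R in
     exists2 minRisk : R,
       is_minimum (Risk @` [set th | simplex th /\ (KL th u <= b%:E)%E]) minRisk
     & (forall T : nat, Tstar = T%:R ->
          holds_with_prob_ge P (success_prob c delta)
            [set w | Risk (theta w T) - minRisk <= bound])
       /\
       (Tstar \isn't a Num.int -> forall T : nat, T%:Z = Num.ceil Tstar ->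
          holds_with_prob_ge P (success_prob c delta)
            [set w | Risk (theta w T) - minRisk <= bound + e_T])).
Proof.
move=> A sigma L f Risk.
have AC i := log_partition_curvature c `|row i X|.
have C0 i := curvature_bound_ge0 c `|row i X|.
have dAP (v : R) : is_derive v 1 A (mean_function c v).
  by have [dAP _] := log_partition_curvature c 0; exact: dAP.
have LE : L = n%:R^-1 * \sum_(i < n) curvature_bound c `|row i X| * `|row i X| ^+ 2.
  exact: smoothness_constE.
split=> [w|].
  by rewrite LE; exact: (loss_smooth AC dAP C0).
move=> eta u delta b eta0 etaL su delta0 b0 sigma0 prov.
move=> theta lambda Tstar bound e_T.
have d_gt0 : (0 < d)%N.
  rewrite lt0n; apply/eqP => d0; have [_] := su; rewrite big1 => [/eqP|j _].
    by rewrite eq_sym oner_eq0.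
  by have := ltn_ord j; rewrite [X in (_ < X)%N]d0.
have RiskE th : Risk th = empirical_loss A X mu th by exact: prediction_riskE.
have cR : continuous Risk.
  have -> : Risk = empirical_loss A X mu by apply/funext => th; exact: RiskE.
  move=> th; apply: differentiable_continuous.
  exact: (differentiable_loss _ dAP).
have [a /KL_ballP[sa au ab] amin] := KL_ball_min su (ltW b0) cR.
exists (Risk a) => //.
have [B [q [mB mgfY truncY ->]]] := noise_subgaussian n_gt0 hparams hlaw prov.
have nR : 0 < n%:R :> R by rewrite ltr0n.
set Lam := ln (2 * d%:R) + delta.
have Lam0 : 0 < Lam.
  rewrite ltr_wpDl// ln_ge0//.
  by have : 1 <= d%:R :> R by [rewrite ler1n]; lra.
have lambda0 : 0 < lambda.
  by rewrite mulr_gt0// sqrtr_gt0 divr_gt0// mulr_gt0.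
have etalambda : 1 / lambda = Tstar * eta.
  by rewrite /Tstar; field; rewrite !gt_eqF.
have Tstar0 : 0 < Tstar by rewrite divr_gt0// mulr_gt0.
have mRisk T : measurable_fun setT (fun w => Risk (theta w T) - Risk a).
  apply: measurable_funB => //.
  under eq_fun do rewrite RiskE.
  apply: (measurable_empirical_loss X (measurable_log_partition c)) => j.
  exact: (measurable_egd Y X dAP (measurable_mean_function c)).
(* Here eta' bounds the rounding of T * eta: it is zero when the optimal stopping
   time is an integer, and eta otherwise. *)
have main T (eta' : R) : 0 <= eta' -> (0 < T)%N ->
    1 / lambda <= T%:R * eta <= 1 / lambda + eta' ->
    holds_with_prob_ge P (1 - expR (- delta) - q)
      [set w | Risk (theta w T) - Risk a <=
        bound + eta' * sigma ^+ 2 * Lam / n%:R].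
  move=> eta'0 T0 TE.
  have mE : measurable [set w | Risk (theta w T) - Risk a <=
      bound + eta' * sigma ^+ 2 * Lam / n%:R].
    have -> : [set w | Risk (theta w T) - Risk a <=
        bound + eta' * sigma ^+ 2 * Lam / n%:R] =
      ~` [set w | bound + eta' * sigma ^+ 2 * Lam / n%:R <
        Risk (theta w T) - Risk a].
      by apply/seteqP; split=> w /=; rewrite leNgt => /negP.
    by apply: measurableC; exact: measurable_gt_set.
  split=> //.
  have small := noise_small_prob hindep n_gt0 d_gt0 hX mB sigma0 delta0 mgfY truncY.
  apply: le_trans small _; apply: le_measure; rewrite ?inE//.
    exact: measurable_noise_small.
  move=> w /= gw; rewrite !RiskE.
  rewrite LE in etaL.
  apply: le_trans (egd_excess_risk AC dAP C0 eta0 etaL su sa au ab T0 gw) _.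
  exact: tuned_bound.
split=> [T TT|nint T TT].
  have T0 : (0 < T)%N by rewrite -(ltr0n R) -TT.
  have := main T 0 (lexx 0) T0.
  rewrite !mul0r !addr0; apply.
  by rewrite -TT etalambda lexx.
have T0 : (0 < T)%N by rewrite -ltz_nat TT ceil_gt0.
have TR : T%:R = (Num.ceil Tstar)%:~R :> R by rewrite -TT.
have /andP[c1 c2] := ceil_itv Tstar.
rewrite intrB -TR in c1; rewrite -TR in c2.
apply: main => //; first exact: ltW.
rewrite etalambda ler_pM2r// c2 /= -[X in _ + X]mul1r -mulrDl ler_pM2r//.
by lra.
Qed.
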